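(* Let $(X_N,x_N,d_N,M_N)_{N\in\mathbb N}$ be a sequence of pointed proper metric spaces endowed with random point processes which converges in the random pointed Lipschitz sense towards $(X,x,d,M)$, where all the point processes are simple and satisfy $M_N(\{x_N\})=0$, $M(\{x\})=0$ almost surely. Assume that $(X,x,d,M)$ is regular. Then, for any fixed $L>0$, the random rooted graphs $\Gamma_{\mathrm{geom}}(X_N,x_N,d_N,M_N,L)$ converge in the local Benjamini--Schramm sense towards $\Gamma_{\mathrm{geom}}(X,x,d,M,L)$.
   Context: A metric space is proper if closed balls are compact. A random point process is a random locally finite sum of Dirac masses $\sum_i\delta_{x_i}$; simple means no atom has multiplicity $>1$. For a homeomorphism $f$, $\mathrm{dil}(f)=\sup_{y\ne z}d'(f(y),f(z))/d(y,z)$. Random pointed Lipschitz convergence $(X_N,x_N,d_N,M_N)\to(X,x,d,M)$: for every $R>0$ there is $N_0(R)$ such that for $N\ge N_0(R)$ there are homeomorphisms $f_{N,R}:B^{X_N}(x_N,R)\to B^X(x,R)$ with $|\log\mathrm{dil}f_{N,R}|+|\log\mathrm{dil}f^{-1}_{N,R}|+d(f_{N,R}(x_N),x)+d_N(x_N,f_{N,R}^{-1}(x))\to0$, and such that for every continuous $\phi:X\to\mathbb R$ compactly supported in the open ball of radius $R$ around $x$, $\sum\phi(f_{N,R}(a))$ over atoms $a$ of $M_N$ in $B^{X_N}(x_N,R)$ converges in law to $\sum\phi(a)$ over atoms $a$ of $M$ in $B^X(x,R)$. $\Gamma_{\mathrm{geom}}(X,x,d,M,L)$ is the graph with vertex set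 $\{x\}\cup\{$atoms of $M\}$, edges between points at distance $\le L$, rooted at $x$ and restricted to the connected component of $x$. Local topology on rooted locally finite connected graphs: $(\Gamma_n,r_n)\to(\Gamma,r)$ iff for each $k$, the balls of graph radius $k$ around the roots are eventually rooted-isomorphic; local Benjamini--Schramm convergence of random rooted graphs is weak convergence of their laws for this topology (equivalently, convergence of the probabilities of each finite radius-$k$ ball). $(X,x,d,M)$ is regular if, for every fixed $L>0$, the map $l\mapsto\Gamma_{\mathrm{geom}}(X,x,d,M,l)$ is almost surely continuous at $l=L$ for the local topology. *)

(* Defs.v *)
From HB Require Import structures.
From mathcomp Require Import all_boot all_order all_algebra.
From mathcomp Require Import all_classical all_reals all_analysis.
From mathcomp Require Import measurable_realfun.
Set Implicit Arguments. Unset Strict Implicit. Unset Printing Implicit Defensive.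
Import Order.TTheory GRing.Theory Num.Theory.
Import numFieldNormedType.Exports.
Local Open Scope classical_set_scope.
Local Open Scope ring_scope.

Section MetricDefs.
Variable R : realType.

Record is_metric (X : Type) (d : X -> X -> R) : Prop := IsMetric {
  dist_ge0 : forall y z, 0 <= d y z;
  dist_eq0 : forall y z, d y z = 0 <-> y = z;
  dist_sym : forall y z, d y z = d z y;
  dist_tri : forall y z w, d y w <= d y z + d z w }.

Definition oball (X : Type) (d : X -> X -> R) (x : X) (r : R) : set X :=
  [set y | d x y < r].
Definition cball (X : Type) (d : X -> X -> R) (x : X) (r : R) : set X :=
  [set y | d x y <= r].

Definition mopen (X : Type) (d : X -> X -> R) (U : set X) : Prop :=
  forall y, U y -> exists2 e : R, 0 < e & oball d y e `<=` U.

Definition mcompact (X : Type) (d : X -> X -> R) (K : set X) : Prop :=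
  forall (I : Type) (U : I -> set X), (forall i, mopen d (U i)) ->
    K `<=` \bigcup_(i in [set: I]) U i ->
    exists2 F : set I, finite_set F & K `<=` \bigcup_(i in F) U i.

Definition mclosure (X : Type) (d : X -> X -> R) (A : set X) : set X :=
  [set y | forall e : R, 0 < e -> exists2 z, A z & d y z < e].

Definition proper_metric (X : Type) (d : X -> X -> R) : Prop :=
  forall y r, mcompact d (cball d y r).

Definition mcont_on (X Y : Type) (dA : X -> X -> R) (dB : Y -> Y -> R)
  (A : set X) (f : X -> Y) : Prop :=
  forall y, A y -> forall e : R, 0 < e -> exists2 del : R, 0 < del &
    forall z, A z -> dA y z < del -> dB (f y) (f z) < e.

Definition mhomeo (X Y : Type) (dX : X -> X -> R) (dY : Y -> Y -> R)
  (A : set X) (B : set Y) (f : X -> Y) (g : Y -> X) : Prop :=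
  [/\ (forall y, A y -> B (f y)), (forall z, B z -> A (g z)),
      (forall y, A y -> g (f y) = y), (forall z, B z -> f (g z) = z) &
      (mcont_on dX dY A f /\ mcont_on dY dX B g)].

Definition dil (X Y : Type) (dX : X -> X -> R) (dY : Y -> Y -> R)
  (A : set X) (f : X -> Y) : \bar R :=
  ereal_sup [set t | exists y z, [/\ A y, A z, y <> z &
                                      t = ((dY (f y) (f z)) / dX y z)%:E]].

Definition msupport (X : Type) (d : X -> X -> R) (phi : X -> R) : set X :=
  mclosure d [set y | phi y != 0].
Definition compactly_supported_in (X : Type) (d : X -> X -> R)
  (phi : X -> R) (U : set X) : Prop :=
  mcompact d (msupport d phi) /\ msupport d phi `<=` U.

Definition Rdist (a b : R) : R := `|a - b|.

Definition mborel (X : Type) (d : X -> X -> R) : set (set X) :=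
  <<s [set U | mopen d U] >>.

(* A configuration (locally finite sum of Dirac masses sum_i delta_{x_i})
   is represented by its multiplicity function m : X -> nat. *)
Definition mass (X : choiceType) (m : X -> nat) (A : set X) : \bar R :=
  \esum_(a in A) ((m a)%:R)%:E.

Definition locally_finite (X : Type) (d : X -> X -> R) (m : X -> nat) : Prop :=
  forall y r, finite_set [set a | d y a <= r /\ (0 < m a)%N].

Definition point_process (X : choiceType) (d : X -> X -> R)
  (dO : measure_display) (Om : measurableType dO) (M : Om -> X -> nat) : Prop :=
  (forall w, locally_finite d (M w)) /\
  (forall A, mborel d A -> measurable_fun setT (fun w => mass (M w) A)).

Definition simple_config (X : Type) (m : X -> nat) : Prop := forall a, (m a <= 1)%N.

Definition atom_sum (X : choiceType) (m : X -> nat) (A : set X) (phi : X -> R) : R :=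
  \sum_(a \in A `&` [set a | (0 < m a)%N]) (m a)%:R * phi a.

Definition cvg_law (dO : nat -> measure_display) (Om : forall N, measurableType (dO N))
  (P : forall N, probability (Om N) R) (Y : forall N, Om N -> R)
  (dO' : measure_display) (Om' : measurableType dO') (P' : probability Om' R)
  (Y' : Om' -> R) : Prop :=
  forall h : R -> R, continuous h -> (exists C : R, forall t, `|h t| <= C) ->
    (fun N => (\int[P N]_w (h (Y N w))%:E)%E) @ \oo --> (\int[P']_w (h (Y' w))%:E)%E.

Definition lip_cvg (X : nat -> choiceType) (x : forall N, X N)
  (d : forall N, X N -> X N -> R)
  (dO : nat -> measure_display) (Om : forall N, measurableType (dO N))
  (P : forall N, probability (Om N) R) (M : forall N, Om N -> X N -> nat)
  (X' : choiceType) (x' : X') (d' : X' -> X' -> R)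
  (dO' : measure_display) (Om' : measurableType dO') (P' : probability Om' R)
  (M' : Om' -> X' -> nat) : Prop :=
  forall r : R, 0 < r ->
  exists (N0 : nat) (f : forall N, X N -> X') (g : forall N, X' -> X N),
  [/\ (forall N, (N0 <= N)%N ->
         mhomeo (d N) d' (cball (d N) (x N) r) (cball d' x' r) (f N) (g N)),
      (forall e : R, 0 < e -> \forall N \near \oo,
         exists a b : R, [/\ 0 < a, 0 < b,
           dil (d N) d' (cball (d N) (x N) r) (f N) = a%:E,
           dil d' (d N) (cball d' x' r) (g N) = b%:E &
           `|ln a| + `|ln b| + d' (f N (x N)) x' + d N (x N) (g N x') < e]) &
      (forall phi : X' -> R, mcont_on d' Rdist setT phi ->
         compactly_supported_in d' phi (oball d' x' r) ->
         cvg_law P (fun N w => atom_sum (M N w) (cball (d N) (x N) r)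
                                        (fun a => phi (f N a)))
                 P' (fun w => atom_sum (M' w) (cball d' x' r) phi))].

Record rgraph := RGraph { rg_type : Type; rg_set : set rg_type;
  rg_adj : rg_type -> rg_type -> Prop; rg_root : rg_type }.

Fixpoint reach (G : rgraph) (k : nat) : set (rg_type G) :=
  match k with
  | 0 => [set v | v = @rg_root G /\ @rg_set G v]
  | k.+1 => [set v | @reach G k v \/
               (@rg_set G v /\ exists2 u, @reach G k u & @rg_adj G u v)]
  end.

Definition rball (G : rgraph) (k : nat) : rgraph :=
  RGraph (@reach G k) (@rg_adj G) (@rg_root G).

Definition riso (G H : rgraph) : Prop :=
  exists phi : rg_type G -> rg_type H,
    [/\ set_bij (@rg_set G) (@rg_set H) phi, phi (@rg_root G) = @rg_root H &
        forall u v, @rg_set G u -> @rg_set G v ->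
          (@rg_adj G u v <-> @rg_adj H (phi u) (phi v))].

Definition fin_rgraph (n : nat) (E : rel 'I_n) (rt : 'I_n) : rgraph :=
  RGraph [set: 'I_n] (fun u v => E u v) rt.

Definition geom_full (X : Type) (d : X -> X -> R) (x : X) (m : X -> nat) (L : R)
  : rgraph :=
  RGraph ([set x] `|` [set a | (0 < m a)%N])
         (fun u v => u <> v /\ d u v <= L) x.

Definition Gamma_geom (X : Type) (d : X -> X -> R) (x : X) (m : X -> nat) (L : R)
  : rgraph :=
  RGraph [set v | exists k, @reach (geom_full d x m L) k v]
         (fun u v => u <> v /\ d u v <= L) x.

Definition local_cvg_seq (G : nat -> rgraph) (H : rgraph) : Prop :=
  forall k, \forall n \near \oo, riso (rball (G n) k) (rball H k).

Definition regular (X : choiceType) (x : X) (d : X -> X -> R)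
  (dO : measure_display) (Om : measurableType dO) (P : probability Om R)
  (M : Om -> X -> nat) : Prop :=
  forall L : R, 0 < L -> {ae P, forall w, forall l : nat -> R, l @ \oo --> L ->
     local_cvg_seq (fun n => Gamma_geom d x (M w) (l n)) (Gamma_geom d x (M w) L)}.

Definition local_BS_cvg (dO : nat -> measure_display)
  (Om : forall N, measurableType (dO N)) (P : forall N, probability (Om N) R)
  (G : forall N, Om N -> rgraph)
  (dO' : measure_display) (Om' : measurableType dO') (P' : probability Om' R)
  (G' : Om' -> rgraph) : Prop :=
  forall (k n : nat) (E : rel 'I_n) (rt : 'I_n),
    (fun N => P N [set w | riso (rball (G N w) k) (fin_rgraph E rt)]) @ \oo -->
    P' [set w | riso (rball (G' w) k) (fin_rgraph E rt)].

End MetricDefs.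

(* Main.v *)
Require Import Defs.
From HB Require Import structures.
From mathcomp Require Import all_boot all_order all_algebra.
From mathcomp Require Import finmap.
From mathcomp Require Import all_classical all_reals all_analysis.
From mathcomp Require Import measurable_realfun ring lra.
Import Order.TTheory GRing.Theory Num.Theory.
Import numFieldNormedType.Exports.
Local Open Scope classical_set_scope.
Local Open Scope ring_scope.
Set Implicit Arguments. Unset Strict Implicit. Unset Printing Implicit Defensive.

(* The radius-[k] ball of the geometric graph depends only on the atoms within
   [k * L] of the root.  Regularity makes it stable under a small change of [L],
   hence under a small perturbation of the atoms and of the metric.  So almost
   every limit configuration lies in one of countably many open patterns
   "exactly one atom in each of n small disjoint balls, and no other atom
   nearby", such that for large N every configuration of [M N] realising the
   pattern (seen through the almost isometry [f N]) has the same radius-[k] ball.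
   The indicator of a finite union of patterns is approximated by linear
   combinations of the functionals exp(- sum of phi over the atoms); these form an
   algebra, and the convergence in law of the one-dimensional sums is enough to
   pass to the limit in their expectations.  This bounds from below the liminf of
   the probability of any property of the radius-[k] ball, and applying it to an
   isomorphism type and to its complement gives convergence. *)

(** * Isomorphisms of rooted graphs *)

Lemma riso_sym (G H : Defs.rgraph) : rg_set (rg_root G) -> riso G H -> riso H G.
Proof.
move=> Gr [phi [[phif phii phis] phir phia]].
have hex v : exists u, rg_set v -> rg_set u /\ phi u = v.
  have [Hv|nHv] := pselect (@rg_set H v); last by exists (rg_root G).
  by have [u Gu <-] := phis v Hv; exists u.
have [psi psiP] := choice hex.
have phiI u v : rg_set u -> rg_set v -> phi u = phi v -> u = v.
  by move=> Gu Gv; apply: phii; rewrite inE.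
exists psi; split.
- split.
  + by move=> v /psiP[].
  + move=> u v; rewrite !inE => Hu Hv uv.
    by rewrite -(psiP _ Hu).2 -(psiP _ Hv).2 uv.
  + move=> u Gu; have Hu := phif u Gu; exists (phi u) => //.
    by have [Gpu pu] := psiP _ Hu; apply: phiI.
(* [phi] is injective on vertices only, so the inverse sends root to root because the root of [G] is
   assumed to be a vertex. *)
- have Hr : rg_set (rg_root H) by rewrite -phir; apply: phif.
  by have [Gpu pu] := psiP _ Hr; apply: phiI => //; rewrite pu phir.
- move=> u v Hu Hv; have [Gu uE] := psiP _ Hu; have [Gv vE] := psiP _ Hv.
  by rewrite -{1}uE -{1}vE phia.
Qed.

Lemma riso_trans (G H K : Defs.rgraph) : riso G H -> riso H K -> riso G K.
Proof.
move=> [f [[ff fi fs] fr fa]] [g [[gf gi gs] gr ga]].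
exists (g \o f); split.
- split.
  + by move=> u Gu; apply/gf/ff.
  + move=> u v uG vG /= gfuv; apply: fi => //; apply: gi => //.
      by move: uG; rewrite !inE => /ff.
    by move: vG; rewrite !inE => /ff.
  + move=> w Kw; have [v Hv <-] := gs w Kw; have [u Gu <-] := fs v Hv.
    by exists u.
- by rewrite /= fr gr.
- by move=> u v Gu Gv; rewrite fa// ga//; apply: ff.
Qed.

(** * Balls in geometric graphs *)

Section GeometricGraphs.
Variable R : realType.
Implicit Types (X : Type) (L : R).

(** A path from the root never leaves the component of the root, so balls can be computed in
    [geom_full], whose vertex set is explicit. *)
Lemma reach_Gamma X (d : X -> X -> R) (x : X) m L k :
  @reach (Gamma_geom d x m L) k = @reach (geom_full d x m L) k.
Proof.
elim: k => [|k IH]; apply/seteqP; split => v /=.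
- by move=> [-> _]; split=> //; left.
- by move=> [-> _]; split=> //; exists 0%N; split=> //; left.
- rewrite IH => -[|[[n vn] [u uk uv]]]; first by left.
  right; split; last by exists u.
  by case: n vn => [[]//|n [vn|[]//]]; elim: n vn => [[]//|n IHn []// []].
- rewrite IH => -[|[vV [u uk uv]]]; first by left.
  by right; split; [exists k.+1; right; split=> //; exists u|exists u].
Qed.

Lemma reach_vertex X (d : X -> X -> R) (x : X) m L k v :
  @reach (geom_full d x m L) k v -> v = x \/ (0 < m v)%N.
Proof. by elim: k v => [|k IH] v /= => [[->]|[/IH//|[]//]]; left. Qed.

Lemma reach_root X (d : X -> X -> R) (x : X) m L k :
  @reach (geom_full d x m L) k x.
Proof. by elim: k => [|k IH]; [split=> //; left|left]. Qed.

Lemma reach_mono X (d : X -> X -> R) (x : X) m L L' j k :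
  L <= L' -> (j <= k)%N ->
  @reach (geom_full d x m L) j `<=` @reach (geom_full d x m L') k.
Proof.
move=> LL' jk; apply: (@subset_trans _ (@reach (geom_full d x m L') j)).
  elim: j {jk} => [//|j IH] v /= [/IH|]; first by left.
  move=> [vV [u /IH uj [nuv uv]]]; right; split=> //; exists u => //; split=> //.
  exact: le_trans LL'.
move/subnK: jk => <-; elim: (k - j)%N => [//|n IH] v /IH; rewrite addSn.
by left.
Qed.

Lemma reach_dist X (d : X -> X -> R) (x : X) m L k v :
  is_metric d -> 0 <= L -> @reach (geom_full d x m L) k v -> d x v <= k%:R * L.
Proof.
move=> dm L0; elim: k v => [|k IH] v /=.
  by move=> [-> _]; rewrite mul0r (dist_eq0 dm x x).2.
rewrite -natr1 mulrDl mul1r => -[/IH|[_ [u /IH xu [_ uv]]]].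
  by move=> /le_trans; apply; rewrite lerDl.
by apply: (le_trans (dist_tri dm x u v)); apply: lerD.
Qed.

Lemma reach_finite X (d : X -> X -> R) (x : X) m L k :
  is_metric d -> locally_finite d m -> 0 <= L ->
  finite_set (@reach (geom_full d x m L) k).
Proof.
move=> dm mf L0.
apply: (@sub_finite_set _ _ ([set x] `|` [set a | d x a <= k%:R * L /\ (0 < m a)%N])).
  move=> v vk; have [->|mv] := reach_vertex vk; first by left.
  by right; split=> //; apply: reach_dist vk.
by rewrite finite_setU; split; [exact: finite_set1|exact: mf].
Qed.

(* The distortion of [sigma] is only controlled between the levels [L1] and
   [L2], so [sigma] sandwiches the [L]-reachable set between the images of the
   [L1]- and [L2]-reachable ones. *)
Lemma geom_ball_riso X X' (d : X -> X -> R) (x : X) m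
    (d' : X' -> X' -> R) (x' : X') m' (L L1 L2 L' : R) k (V' : set X')
    (sigma : X' -> X) :
  is_metric d -> 0 <= L -> L1 <= L' -> L' <= L2 ->
  V' `<=` [set x'] `|` [set a | (0 < m' a)%N] ->
  @reach (geom_full d' x' m' L1) k `<=` V' ->
  (forall u v, V' u -> V' v -> sigma u = sigma v -> u = v) ->
  sigma x' = x ->
  (forall u, V' u -> sigma u = x \/ (0 < m (sigma u))%N) ->
  (forall v, v = x \/ (0 < m v)%N -> d x v <= k%:R * L ->
     exists2 u, V' u & sigma u = v) ->
  (forall u v, V' u -> V' v -> d' u v <= L1 -> d (sigma u) (sigma v) <= L) ->
  (forall u v, V' u -> V' v -> d (sigma u) (sigma v) <= L -> d' u v <= L2) ->
  @reach (geom_full d' x' m' L2) k `<=` @reach (geom_full d' x' m' L1) k ->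
  (forall u v, @reach (geom_full d' x' m' L1) k u ->
     @reach (geom_full d' x' m' L1) k v -> d' u v <= L2 -> d' u v <= L1) ->
  riso (rball (Gamma_geom d' x' m' L') k) (rball (Gamma_geom d x m L) k).
Proof.
move=> dm L0 L1L' L'L2 V'm' rV' sI sx sV sS h1 h2 h3 h4.
have L12 := le_trans L1L' L'L2.
have rE : @reach (geom_full d' x' m' L') k = @reach (geom_full d' x' m' L1) k.
  apply/seteqP; split; last exact: (reach_mono L1L' (leqnn k)).
  by move=> v vk; apply: h3; exact: (reach_mono L'L2 (leqnn k)) vk.
(* Paths push forward along [sigma] from level [L1] to level [L]. *)
have dn j v : (j <= k)%N -> @reach (geom_full d' x' m' L1) j v ->
    @reach (geom_full d x m L) j (sigma v).
  elim: j v => [|j IH] v jk /=.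
    by move=> [-> _]; rewrite sx; split=> //; left.
  move=> [/(IH _ (ltnW jk))|[vV [u uj [nuv uv]]]]; first by left.
  have Vu : V' u by apply/rV'; apply: (reach_mono (lexx L1) (ltnW jk)) uj.
  have Vv : V' v.
    apply/rV'; apply: (reach_mono (lexx L1) jk); right; split => //.
    by exists u.
  right; split; first exact: sV.
  exists (sigma u); first exact: IH (ltnW jk) uj.
  by split; [move=> /(sI _ _ Vu Vv)|exact: h1].
(* Paths lift from level [L] to level [L2]. Every vertex reached in at most [k] steps lies within
   [k%:R * L] of the root, hence has a preimage in [V']; injectivity makes the lifts of successive
   steps agree. *)
have up j v : (j <= k)%N -> @reach (geom_full d x m L) j v ->
    exists2 u, V' u /\ @reach (geom_full d' x' m' L2) j u & sigma u = v.
  elim: j v => [|j IH] v jk.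
    move=> [-> _]; exists x' => //; split; last exact: reach_root.
    by apply: rV'; exact: reach_root.
  move=> vj; have [u Vu uv] : exists2 u, V' u & sigma u = v.
    apply: sS; first exact: reach_vertex vj.
    by apply: reach_dist (reach_mono (lexx L) jk vj).
  exists u => //; split=> //; case: vj => [vj|[vV [w wj [nwv wv]]]].
    have [u' [Vu' u'j] u'v] := IH _ (ltnW jk) vj.
    by left; rewrite (sI _ _ Vu Vu') // uv u'v.
  have [u' [Vu' u'j] u'w] := IH _ (ltnW jk) wj.
  right; split; first exact: V'm'.
  exists u' => //; split; first by move=> uu'; apply: nwv; rewrite -u'w -uv uu'.
  by apply: h2 => //; rewrite u'w uv.
exists sigma; split; rewrite /rball /=.
- split; rewrite ?reach_Gamma rE.
  + by move=> v /(dn _ _ (leqnn k)).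
  + by move=> u v; rewrite !inE => /rV' Vu /rV' Vv; apply: sI.
  + by move=> v /(up _ _ (leqnn k)) [u [Vu uk] <-]; exists u => //; apply: h3.
- exact: sx.
- move=> u v; rewrite reach_Gamma rE => uk vk.
  have Vu := rV' _ uk; have Vv := rV' _ vk.
  split=> -[nuv uv]; split.
  + by move=> /(sI _ _ Vu Vv).
  + by apply: h1 => //; apply: h4 => //; apply: le_trans L'L2.
  + by move=> uvE; apply: nuv; rewrite uvE.
  + by apply: le_trans L1L'; apply: h4 => //; apply: h2.
Qed.

End GeometricGraphs.

(** * Stability of balls under a change of the connection radius *)

Lemma finite_inj_subset (T : choiceType) (A B : set T) (f : T -> T) :
  finite_set B -> A `<=` B -> set_inj B f -> (forall b, B b -> A (f b)) ->
  B `<=` A.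
Proof.
move=> Bf AB fI fBA.
have Af : finite_set A := sub_finite_set AB Bf.
have sub : (fset_set A `<=` fset_set B)%fset.
  by apply/fsubsetP => a; rewrite !in_fset_set// !inE => /AB.
have : (#|` fset_set B| <= #|` fset_set A|)%N.
  have fI' : {in fset_set B &, injective f}.
    by move=> a b; rewrite !in_fset_set//; apply: fI.
  rewrite -(card_in_imfset imfset_key (p := mem (fset_set B)) fI').
  apply/fsubset_leq_card/fsubsetP => a /imfsetP[b /= bB ->].
  by move: bB; rewrite !in_fset_set// !inE => /fBA.
move=> cBA; have /eqP AE : fset_set A == fset_set B by rewrite eqEfcard sub.
move=> b Bb; have : b \in fset_set A by rewrite AE in_fset_set// inE.
by rewrite in_fset_set// inE.
Qed.

(** The isomorphism is arbitrary, so it does not identify the balls by itself. But the balls are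
    finite and nested, and an injection of the larger into the smaller forces equality by counting;
    the same count is then made on edges. *)
Lemma riso_geom_stable (R : realType) (X : choiceType) (d : X -> X -> R)
    (x : X) m (l1 l2 : R) k :
  is_metric d -> locally_finite d m -> 0 <= l1 -> l1 <= l2 ->
  riso (rball (Gamma_geom d x m l2) k) (rball (Gamma_geom d x m l1) k) ->
  @reach (geom_full d x m l2) k `<=` @reach (geom_full d x m l1) k /\
  (forall u v, @reach (geom_full d x m l1) k u ->
     @reach (geom_full d x m l1) k v -> d u v <= l2 -> d u v <= l1).
Proof.
move=> dm mf l10 l12 [phi [[]]]; rewrite /rball /= !reach_Gamma.
move=> phif phii phis _ phia.
have l20 := le_trans l10 l12.
set B := @reach (geom_full d x m l2) k in phif phii phis phia *.
set A := @reach (geom_full d x m l1) k in phif phii phis phia *.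
have AB : A `<=` B := reach_mono l12 (leqnn k).
have Bf : finite_set B := reach_finite x k dm mf l20.
have BA : B `<=` A := finite_inj_subset Bf AB phii phif.
split => // u v Au Av uv2.
have [<-|nuv] := pselect (u = v); first by rewrite (dist_eq0 dm u u).2.
(* Oriented edges of length at most [l] inside the larger ball: [phi] injects those for [l2] into
   those for [l1]. *)
pose Ed l := [set p : X * X | [/\ B p.1, B p.2, p.1 <> p.2 & d p.1 p.2 <= l]].
have phiI a b : B a -> B b -> phi a = phi b -> a = b.
  by move=> Ba Bb; apply: phii; rewrite inE.
have : Ed l2 `<=` Ed l1.
  apply: (@finite_inj_subset _ _ _ (fun p => (phi p.1, phi p.2))).
  - apply: sub_finite_set (finite_setX Bf Bf).
    by move=> p [].
  - by move=> p [? ? ? /le_trans pl]; split=> //; apply: pl.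
  - move=> [a b] [a' b']; rewrite !inE => -[/= Ba Bb _ _] [/= Ba' Bb' _ _].
    by move=> [/(phiI _ _ Ba Ba') -> /(phiI _ _ Bb Bb') ->].
  - move=> [a b] [/= Ba Bb nab ab]; split => /=.
    + exact/AB/phif.
    + exact/AB/phif.
    + by move=> /(phiI _ _ Ba Bb).
    + by have [[]] := phia a b Ba Bb.
move=> /(_ (u, v)) []//=; split=> //; exact: AB.
Qed.

(** Regularity is tested along [L - 1/(n+1)] and [L + 1/(n+1)]: for some [n] both balls are
    isomorphic to the ball at [L], hence to each other, and [riso_geom_stable] applies. *)
Lemma regular_stable (R : realType) (X : choiceType) (d : X -> X -> R) (x : X)
    m (L : R) k :
  is_metric d -> locally_finite d m -> 0 < L ->
  (forall l : nat -> R, l @ \oo --> L ->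
     local_cvg_seq (fun n => Gamma_geom d x m (l n)) (Gamma_geom d x m L)) ->
  exists del : R, [/\ 0 < del, del <= L,
  @reach (geom_full d x m (L + del)) k `<=` @reach (geom_full d x m (L - del)) k &
  (forall u v, @reach (geom_full d x m (L - del)) k u ->
     @reach (geom_full d x m (L - del)) k v -> d u v <= L + del -> d u v <= L - del)].
Proof.
move=> dm mf L0 reg.
have hm : (fun n => L - n.+1%:R^-1) @ \oo --> L.
  rewrite -[X in _ --> X]subr0; apply: cvgB; first exact: cvg_cst.
  exact: cvg_harmonic.
have hp : (fun n => L + n.+1%:R^-1) @ \oo --> L.
  rewrite -[X in _ --> X]addr0; apply: cvgD; first exact: cvg_cst.
  exact: cvg_harmonic.
have hL : \forall n \near \oo, n.+1%:R^-1 < L.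
  by have /cvgr_lt := @cvg_harmonic R; apply.
have /filter_ex [n [[rm rp] nL]] : \forall n \near \oo,
   (riso (rball (Gamma_geom d x m (L - n.+1%:R^-1)) k) (rball (Gamma_geom d x m L) k)
   /\ riso (rball (Gamma_geom d x m (L + n.+1%:R^-1)) k) (rball (Gamma_geom d x m L) k))
   /\ n.+1%:R^-1 < L.
  apply: filterI => //; apply: filterI; first exact: reg hm k.
  exact: reg hp k.
have n0 : 0 < n.+1%:R^-1 :> R by rewrite invr_gt0.
exists n.+1%:R^-1.
have l10 : 0 <= L - n.+1%:R^-1 by rewrite subr_ge0 ltW.
have l12 : L - n.+1%:R^-1 <= L + n.+1%:R^-1 by rewrite lerD2l ge0_cp// ltW.
have [|h1 h2] := riso_geom_stable (x := x) (k := k) dm mf l10 l12.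
  apply: riso_trans rp _; apply: riso_sym rm => /=.
  by rewrite reach_Gamma; exact: reach_root.
by split => //; apply: ltW.
Qed.

Lemma finite_pos_lower_bound (R : realType) (T : choiceType) (A : set T)
    (g : T -> R) :
  finite_set A -> (forall a, A a -> 0 < g a) ->
  exists2 e : R, 0 < e & forall a, A a -> e <= g a.
Proof.
move=> Af g0.
have [s sA] : exists s : seq T, forall a, A a <-> a \in s.
  by exists (fset_set A) => a; rewrite in_fset_set// inE.
have {g0} : forall a, a \in s -> 0 < g a by move=> a /sA /g0.
move=> g0; suff [e e0 eg] : exists2 e : R, 0 < e & forall a, a \in s -> e <= g a.
  by exists e => // a /sA /eg.
elim: s g0 {sA} => [|b s IH] g0; first by exists 1.
have [a sa|e e0 eg] := IH; first by apply: g0; rewrite in_cons sa orbT.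
exists (Num.min e (g b)); first by rewrite lt_min e0 g0// mem_head.
move=> a; rewrite in_cons => /orP[/eqP ->|/eg ega]; first by rewrite ge_min lexx orbT.
by rewrite ge_min ega.
Qed.

(** * Topology of proper metric spaces *)

Section MetricTopology.
Variables (R : realType) (X : choiceType) (d : X -> X -> R).
Hypothesis dm : is_metric d.

Lemma mopen_oball c e : mopen d (oball d c e).
Proof.
move=> y; rewrite /oball /= => cy; exists (e - d c y); first by rewrite subr_gt0.
move=> z; rewrite /oball /= => yz; have := dist_tri dm c y z; lra.
Qed.

Lemma mopenC_cball c e : mopen d (~` cball d c e).
Proof.
move=> y /negP; rewrite -ltNge => cy; exists (d c y - e); first by rewrite subr_gt0.
move=> z; rewrite /oball /cball /= => yz; apply/negP; rewrite -ltNge.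
have := dist_tri dm c z y; rewrite (dist_sym dm z y); lra.
Qed.

Lemma mopen_bigcup (I : Type) (D : set I) (U : I -> set X) :
  (forall i, D i -> mopen d (U i)) -> mopen d (\bigcup_(i in D) U i).
Proof.
move=> Uo y [i Di Uiy]; have [e e0 eU] := Uo i Di y Uiy.
by exists e => // z /eU; exists i.
Qed.

Lemma mopen_setU (U V : set X) : mopen d U -> mopen d V -> mopen d (U `|` V).
Proof.
move=> Uo Vo y [/Uo|/Vo] [e e0 eU]; exists e => // z /eU; by [left|right].
Qed.

Lemma mborel_setC (A : set X) : mopen d (~` A) -> mborel d A.
Proof.
move=> Ao; rewrite -(setCK A) -setTD; apply: sigma_algebraCD.
exact: sub_sigma_algebra.
Qed.

Lemma mcompact_closed (K C : set X) :
  mcompact d K -> C `<=` K -> mopen d (~` C) -> mcompact d C.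
Proof.
move=> Kc CK Co I U Uo CU.
(* The cover of [C] is completed to a cover of [K] by the complement of [C], indexed by [None]. *)
have [||F Ff KF] := Kc (option I) (fun i => if i is Some j then U j else ~` C).
- by case.
- move=> y Ky; have [/CU[i _ Uy]|nCy] := pselect (C y); first by exists (Some i).
  by exists None.
- exists (Some @^-1` F); first by apply: finite_preimage => // i j _ _ [].
  by move=> y Cy; have [[i|] Fi Uiy] := KF y (CK y Cy); [exists i|].
Qed.

(** Every ball of integer radius has a finite net at each scale, and these nets together are
    countable. Naming centres by natural numbers keeps the later families of patterns countable. *)
Lemma proper_dense_sequence (x : X) : proper_metric d ->
  exists D : nat -> X, forall y (e : R), 0 < e -> exists n, d (D n) y < e.
Proof.
move=> dp.
have hex (p : nat * nat) : exists F : set X, finite_set F /\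
    cball d x p.1%:R `<=` \bigcup_(c in F) oball d c p.2.+1%:R^-1.
  have [|y _|F Ff FK] := dp x p.1%:R X (fun c => oball d c p.2.+1%:R^-1).
  - by move=> c; exact: mopen_oball.
  - by exists y => //; rewrite /oball /= (dist_eq0 dm y y).2//.
  - by exists F.
have [F FP] := choice hex.
have /countable_injP[f fI] : countable (\bigcup_(p in [set: nat * nat]) F p).
  apply: bigcup_countable => [|p _]; first exact: countableP.
  exact: finite_set_countable (FP p).1.
(* [x] is the value at the numbers that code no net point. *)
pose D n := xget x [set a | (\bigcup_(p in [set: nat * nat]) F p) a /\ f a = n].
exists D => y e e0.
have [m] : exists m : nat, m.+1%:R^-1 < e.
  have /cvgr_lt/(_ e e0) := @cvg_harmonic R.
  by move=> /filter_ex [m]; exists m.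
have [n yn] : exists n : nat, d x y <= n%:R.
  by exists (Num.truncn (d x y)).+1; apply/ltW/truncnS_gt.
move=> me; have [c Fc cy] := (FP (n, m)).2 y yn.
exists (f c); rewrite /D; case: xgetP => [a _ [[p _ Fpa] fa]|/(_ c)[]].
  have -> : a = c by apply: fI => //; rewrite inE; [exists p|exists (n, m)].
  exact: lt_trans me.
by split => //; exists (n, m).
Qed.

Lemma mass_gt0 (m : X -> nat) (A : set X) :
  (0 < mass R m A)%E <-> exists2 a, A a & (0 < m a)%N.
Proof.
split=> [|[a Aa ma]].
  apply: contraPP => nex; rewrite /mass esum1 ?ltxx// => a Aa.
  by have [ma|] := posnP (m a); [rewrite ma|move=> ma; exfalso; apply: nex; exists a].
apply: (@lt_le_trans _ _ ((m a)%:R)%:E); first by rewrite lte_fin ltr0n.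
apply: esum_ge; exists [set a]; last by rewrite fsbig_set1.
by split; [exact: finite_set1|move=> _ ->].
Qed.

End MetricTopology.

(* [Fine] need not be measurable: [T] is the liminf of the unions of those
   [H m c] that meet [T] and [Fine m]. *)
Lemma measurable_of_approx (dO : measure_display) (Om : measurableType dO)
    (I : countType) (T : set Om) (H : nat -> I -> set Om) (Fine : nat -> set Om) :
  (forall m c, measurable (H m c)) ->
  (forall w, \forall m \near \oo, Fine m w) ->
  (forall m w, exists c, H m c w) ->
  (forall m c w w', Fine m w -> Fine m w' -> H m c w -> H m c w' -> T w -> T w') ->
  measurable T.
Proof.
move=> Hm Fn Hex HT.
pose good m c := exists w, [/\ T w, Fine m w & H m c w].
pose U m := \bigcup_(c in [set: I]) (if `[< good m c >] then H m c else set0).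
have -> : T = \bigcup_n \bigcap_(m in [set m | (n <= m)%N]) U m.
  apply/seteqP; split=> w.
    move=> Tw; have [n _ nF] := Fn w; exists n => // m /nF Fm.
    have [c Hc] := Hex m w; exists c => //; case: asboolP => // -[].
    by exists w.
  move=> [n _ nU].
  have /filter_ex[m [Fm nm]] : \forall m \near \oo, Fine m w /\ (n <= m)%N.
    by apply: filterI; [exact: Fn|exact: nbhs_infty_ge].
  have [c _] := nU m nm; case: asboolP => // -[w' [Tw' Fw' Hw']] Hw.
  exact: HT Fw' Fm Hw' Hw Tw'.
apply: bigcup_measurable => n _; apply: bigcap_measurableType => m _.
apply: countable_bigcupT_measurable; first exact: countableP.
by move=> c; case: asboolP.
Qed.

(** * Measurability of the isomorphism type of a ball *)

Section MeasurableBallEvent.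
Variables (R : realType) (X : choiceType) (d : X -> X -> R) (x : X).
Hypotheses (dm : is_metric d) (dp : proper_metric d).
Variables (dO : measure_display) (Om : measurableType dO) (M : Om -> X -> nat).
Hypothesis Mpp : point_process d M.

(** The root is a vertex whether or not it is an atom, so the event is sure when [A] contains it;
    otherwise it says that [A] has positive mass. *)
Lemma measurable_hit (A : set X) : mopen d (~` A) ->
  measurable [set w | exists2 a, A a & a = x \/ (0 < M w a)%N].
Proof.
move=> Ao; have [Ax|nAx] := pselect (A x).
  rewrite (_ : [set w | _] = setT); first exact: measurableT.
  by apply/seteqP; split=> // w _; exists x => //; left.
rewrite (_ : [set w | _] = setT `&` [set w | (0 < mass R (M w) A)%E]).
  by apply: emeasurable_fun_o_infty => //; apply: Mpp.2; exact: mborel_setC.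
rewrite setTI; apply/seteqP; split=> w /=.
  by move=> [a Aa [ax|ma]]; [exfalso; apply: nAx; rewrite -ax|apply/mass_gt0; exists a].
by move=> /mass_gt0[a Aa ma]; exists a => //; right.
Qed.

(** At scale [eps m] a configuration is coded by a finite list of centres. Two configurations that
    share a code and are well separated at that scale are matched by moving vertices by at most
    [2 * eps m], too little to create or destroy an edge. *)
Lemma measurable_ball_event (L : R) k n (E : rel 'I_n) (rt : 'I_n) :
  0 <= L ->
  measurable [set w | riso (rball (Gamma_geom d x (M w) L) k) (fin_rgraph E rt)].
Proof.
move=> L0; set T := [set w | _].
have [D Dd] := proper_dense_sequence dm x dp.
pose K := cball d x (k%:R * L).
pose V w : set X := [set a | K a /\ (a = x \/ (0 < M w a)%N)].
pose eps (m : nat) : R := m.+1%:R^-1.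
have eps0 m : 0 < eps m by rewrite invr_gt0.
(* Both conditions ask whether closed sets are hit: each listed closed ball contains a vertex lying
   in [K], and no vertex in [K] escapes all the listed open balls. *)
pose H m (c : seq nat) : set Om :=
  (\bigcap_(i in [set` c]) [set w | exists2 a, (cball d (D i) (eps m) `&` K) a &
     a = x \/ (0 < M w a)%N]) `&`
  ~` [set w | exists2 a, (K `\` \bigcup_(i in [set` c]) oball d (D i) (eps m)) a &
     a = x \/ (0 < M w a)%N].
(* A fixed configuration has finitely many vertices in [K], so its positive distances, and their
   positive excesses over [L], are all larger than [4 * eps m] once [m] is large. *)
pose Fine m w := forall u v, V w u -> V w v ->
  (u <> v -> 4 * eps m < d u v) /\ (L < d u v -> L + 4 * eps m < d u v).
have Vf w : finite_set (V w).
  apply: (@sub_finite_set _ _ ([set x] `|` [set a | d x a <= k%:R * L /\ (0 < M w a)%N])).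
    by move=> a [Ka [->|ma]]; [left|right].
  by rewrite finite_setU; split; [exact: finite_set1|exact: Mpp.1].
apply: (@measurable_of_approx _ _ _ T H Fine).
- move=> m c; apply: measurableI.
    apply: bigcap_measurableType => i _; apply: measurable_hit.
    by rewrite setCI; apply: mopen_setU; exact: mopenC_cball.
  apply: measurableC; apply: measurable_hit.
  rewrite setCD; apply: mopen_setU; first exact: mopenC_cball.
  by apply: mopen_bigcup => i _; exact: mopen_oball.
- move=> w.
  pose g (p : X * X) := Num.min (if p.1 == p.2 then 1 else d p.1 p.2)
    (if L < d p.1 p.2 then d p.1 p.2 - L else 1).
  have [p [Vu Vv]|e e0 eg] := finite_pos_lower_bound (g := g) (finite_setX (Vf w) (Vf w)).
    rewrite /g lt_min; apply/andP; split.
      case: eqP => // npp; rewrite lt0r (dist_ge0 dm) andbT.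
      by apply/eqP => /(dist_eq0 dm).
    by case: ifP => // Lp; rewrite subr_gt0.
  have e4 : 0 < e / 4 by rewrite divr_gt0.
  have : \forall m \near \oo, eps m < e / 4.
    by have /cvgr_lt := @cvg_harmonic R; apply.
  apply: filterS => m me u v Vu Vv.
  have := eg (u, v) (conj Vu Vv); rewrite /g /= le_min => /andP[h1 h2].
  split=> [nuv|Luv].
    by move: h1; case: eqP => // _; lra.
  by move: h2; rewrite Luv; lra.
- move=> m w.
  have hex a : exists i, d (D i) a < eps m by apply: Dd.
  have [i iP] := choice hex.
  exists [seq i a | a <- fset_set (V w)]; split.
    move=> _ /mapP[a aV ->]; move: aV; rewrite in_fset_set// inE => -[Ka Va].
    by exists a => //; split=> //; rewrite /cball /= ltW.
  move=> [a [Ka na] Va]; apply: na; exists (i a); last exact: iP.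
  by apply: map_f; rewrite in_fset_set// inE.
- move=> m c w w' Fw Fw' Hw Hw' Tw.
  have step w1 w2 u : H m c w1 -> H m c w2 -> V w1 u ->
      exists2 v, V w2 v & d u v <= 2 * eps m.
    move=> [_ h1] [h2 _] Vu.
    have [i ci ui] : exists2 i, i \in c & d (D i) u < eps m.
      apply: contrapT => nex; apply: h1; exists u; last exact: Vu.2.
      by split; [exact: Vu.1|move=> [i ci ui]; apply: nex; exists i].
    have [v [vi Kv] Vv] := h2 i ci; exists v => //.
    rewrite /cball /= in vi; have := dist_tri dm u (D i) v.
    by rewrite (dist_sym dm u (D i)); lra.
  have hex u : exists v, V w u -> V w' v /\ d u v <= 2 * eps m.
    have [Vu|nVu] := pselect (V w u); last by exists x.
    by have [v Vv uv] := step w w' u Hw Hw' Vu; exists v.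
  have [s sP] := choice hex.
  have kL0 : 0 <= k%:R * L by rewrite mulr_ge0.
  have Vx w1 : V w1 x by split; [rewrite /K /cball /= (dist_eq0 dm x x).2|left].
  have close w1 u v : Fine m w1 -> V w1 u -> V w1 v -> d u v <= 4 * eps m -> u = v.
    move=> F1 Vu Vv uv; apply: contrapT => nuv; have := (F1 u v Vu Vv).1 nuv.
    by rewrite ltNge uv.
  (* The source of the factor 4 in [Fine]: two endpoints, each displaced by at most [2 * eps m]. *)
  have dist u v u' v' : d u u' <= 2 * eps m -> d v v' <= 2 * eps m ->
      d u' v' <= d u v + 4 * eps m.
    have := dist_tri dm u' u v'; have := dist_tri dm u v v'.
    rewrite (dist_sym dm u' u); lra.
  have uu u : d u u = 0 by apply/(dist_eq0 dm).
  suff : riso (rball (Gamma_geom d x (M w) L) k) (rball (Gamma_geom d x (M w') L) k).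
    move=> ww'; apply: riso_trans Tw; apply: riso_sym ww' => /=.
    by rewrite reach_Gamma; exact: reach_root.
  have rV : @reach (geom_full d x (M w) L) k `<=` V w.
    by move=> v vk; split; [exact: reach_dist vk|exact: reach_vertex vk].
  apply: (@geom_ball_riso R X X d x (M w') d x (M w) L L L L k (V w) s) => //.
  + by move=> u [_ [->|]]; [left|right].
  + move=> u v Vu Vv suv; apply: (close w) => //.
    have [_ h1] := sP u Vu; have [_ h2] := sP v Vv.
    have := dist (s u) (s v) u v; rewrite (dist_sym dm (s u) u).
    by rewrite (dist_sym dm (s v) v) suv uu add0r; rewrite suv in h1; exact.
  + have [h1 h2] := sP x (Vx w); apply: (close w') => //.
    by rewrite (dist_sym dm); have := eps0 m; lra.
  + by move=> u Vu; have [[_ h1] _] := sP u Vu.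
  + move=> v Vv xv; have [u Vu vu] := step w' w v Hw' Hw (conj xv Vv).
    exists u => //; have [h1 h2] := sP u Vu; apply: (close w') => //.
    have := dist u u (s u) v h2; rewrite uu add0r; apply.
    by rewrite (dist_sym dm).
  + move=> u v Vu Vv uvL; have [h1 h2] := sP u Vu; have [h3 h4] := sP v Vv.
    rewrite leNgt; apply/negP => /(Fw' _ _ h1 h3).2.
    have := dist u v _ _ h2 h4; lra.
  + move=> u v Vu Vv uvL; have [h1 h2] := sP u Vu; have [h3 h4] := sP v Vv.
    rewrite leNgt; apply/negP => /(Fw _ _ Vu Vv).2.
    have := dist (s u) (s v) u v; rewrite (dist_sym dm (s u) u) (dist_sym dm (s v) v).
    move=> /(_ h2 h4); lra.
Qed.

End MeasurableBallEvent.

(** * Sums over atoms and their measurability *)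

Section AtomSum.
Variables (R : realType) (X : choiceType).
Implicit Types (m : X -> nat) (A B : set X) (h : X -> R).

Lemma atom_sumE m A h : finite_set (A `&` [set a | (0 < m a)%N]) ->
  atom_sum m A h =
  \sum_(a <- fset_set (A `&` [set a | (0 < m a)%N])) (m a)%:R * h a.
Proof. exact: fsbig_finite. Qed.

Lemma atom_sumD m A h1 h2 : finite_set (A `&` [set a | (0 < m a)%N]) ->
  atom_sum m A (fun a => h1 a + h2 a) = atom_sum m A h1 + atom_sum m A h2.
Proof.
move=> Af; rewrite !atom_sumE// -big_split; apply: eq_bigr => a _.
exact: mulrDr.
Qed.

Lemma atom_sumZ m A h c : finite_set (A `&` [set a | (0 < m a)%N]) ->
  atom_sum m A (fun a => c * h a) = c * atom_sum m A h.
Proof.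
move=> Af; rewrite !atom_sumE// big_distrr; apply: eq_bigr => a _ /=.
by rewrite mulrCA.
Qed.

Lemma atom_sum_sum m A n (h : 'I_n -> X -> R) :
  finite_set (A `&` [set a | (0 < m a)%N]) ->
  atom_sum m A (fun a => \sum_(j < n) h j a) = \sum_(j < n) atom_sum m A (h j).
Proof.
move=> Af; rewrite !atom_sumE//; under [RHS]eq_bigr do rewrite atom_sumE//.
rewrite exchange_big; apply: eq_bigr => a _ /=.
by rewrite big_distrr.
Qed.

Lemma atom_sum_ge0 m A h : finite_set (A `&` [set a | (0 < m a)%N]) ->
  (forall a, A a -> 0 <= h a) -> 0 <= atom_sum m A h.
Proof.
move=> Af h0; rewrite atom_sumE// big_seq; apply: sumr_ge0 => a.
by rewrite in_fset_set// inE => -[Aa _]; rewrite mulr_ge0// h0.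
Qed.

Lemma atom_sum_dist m A h1 h2 (e : R) :
  finite_set (A `&` [set a | (0 < m a)%N]) ->
  (forall a, A a -> `|h1 a - h2 a| <= e) ->
  `|atom_sum m A h1 - atom_sum m A h2| <= e * atom_sum m A (cst 1).
Proof.
move=> Af he; rewrite !atom_sumE// -sumrB (le_trans (ler_norm_sum _ _ _))//.
rewrite big_distrr /= [leLHS]big_seq [leRHS]big_seq; apply: ler_sum => a.
rewrite in_fset_set// inE => -[/he ha _].
by rewrite -mulrBr normrM ger0_norm// mulr1 mulrC ler_wpM2r.
Qed.

Lemma mass_atom_sum m A B : finite_set (A `&` [set a | (0 < m a)%N]) ->
  B `<=` A -> mass R m B = (atom_sum m A \1_B)%:E.
Proof.
move=> Af BA; rewrite atom_sumE// /mass.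
transitivity (\esum_(a in A `&` [set a | (0 < m a)%N])
    ((m a)%:R * (\1_B a : R))%:E)%E; last first.
  rewrite esum_fset//.
  by rewrite fsbig_finite//= sumEFin.
rewrite [LHS]esum_mkcond [RHS]esum_mkcond; apply: eq_esum => a _.
rewrite indicE; have [Ba|nBa] := boolP (a \in B); last first.
  by rewrite mulr0; case: ifP.
rewrite mulr1; case: ifP => // /negbT naA.
have [->//|ma] := posnP (m a); move: naA; rewrite notin_setE => -[].
by split=> //; apply: BA; rewrite inE in Ba.
Qed.

Lemma atom_sum_ge_size m A h (s : seq X) :
  finite_set (A `&` [set a | (0 < m a)%N]) -> (forall a, A a -> 0 <= h a) ->
  uniq s -> (forall a, a \in s -> [/\ A a, (0 < m a)%N & 1 <= h a]) ->
  (size s)%:R <= atom_sum m A h.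
Proof.
move=> Af h0 us sP; rewrite atom_sumE//.
set S := fset_set _.
have sS a : a \in s -> a \in S.
  by move=> /sP[Aa ma _]; rewrite in_fset_set// inE.
have : \sum_(a <- S | a \in s) 1 <= \sum_(a <- S) (m a)%:R * h a.
  rewrite big_mkcond [leLHS]big_seq [leRHS]big_seq; apply: ler_sum => a.
  rewrite in_fset_set// inE => -[Aa ma]; case: ifP => [/sP[_ _ h1]|_].
    by rewrite -[leLHS]mulr1 ler_pM// ler1n.
  by rewrite mulr_ge0// h0.
apply: le_trans; rewrite -big_filter.
have pe : perm_eq [seq a <- S | a \in s] s.
  apply: uniq_perm => //; first by rewrite filter_uniq// fset_uniq.
  by move=> a; rewrite mem_filter andb_idr// => /sS.
by rewrite (perm_big _ pe) big_const_seq count_predT iter_addr_0.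
Qed.

Lemma atom_sum_le_size m A h (s : seq X) :
  finite_set (A `&` [set a | (0 < m a)%N]) ->
  (forall a, A a -> (0 < m a)%N -> (a \in s /\ (m a)%:R * h a <= 1) \/ h a = 0) ->
  atom_sum m A h <= (size s)%:R.
Proof.
move=> Af hs; rewrite atom_sumE//; set S := fset_set _.
apply: (@le_trans _ _ (\sum_(a <- S | a \in s) 1)).
  rewrite [leRHS]big_mkcond [leLHS]big_seq [leRHS]big_seq; apply: ler_sum => a.
  rewrite in_fset_set// inE => -[Aa ma]; case: (hs a Aa ma) => [[-> //]|->].
  by rewrite mulr0; case: ifP.
rewrite -big_filter big_const_seq count_predT iter_addr_0 ler_nat.
apply: uniq_leq_size; first by rewrite filter_uniq// fset_uniq.
by move=> a; rewrite mem_filter => /andP[].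
Qed.

End AtomSum.

(** The sum counts the positive integers up to [y], so it is the integer part of [y]. *)
Lemma count_le_approx (R : realType) (J : nat) (y : R) : 0 <= y <= J%:R ->
  `|y - \sum_(j < J) (j.+1%:R <= y)%R%:R| <= 1.
Proof.
move=> /andP[y0 yJ].
suff [h1 h2] : (J%:R <= y -> \sum_(j < J) (j.+1%:R <= y)%R%:R = J%:R :> R) /\
   (y < J%:R -> y - 1 <= \sum_(j < J) ((j.+1%:R <= y)%R%:R : R) <= y).
  have [Jy|/h2] := leP J%:R y; last by rewrite ler_norml; lra.
  by rewrite h1// (@le_anti _ _ y J%:R) ?yJ// subrr normr0.
elim: J {yJ} => [|J [IH1 IH2]]; first by rewrite big_ord0; split; lra.
rewrite big_ord_recr /=; split=> [Jy|yJ].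
  rewrite Jy IH1 ?natr1// (le_trans _ Jy)// ler_nat//.
have -> : (J.+1%:R <= y) = false by rewrite leNgt yJ.
rewrite addr0; have [Jy|/IH2//] := leP J%:R y.
by rewrite IH1// Jy; move: yJ; rewrite -natr1; lra.
Qed.

Section MeasurableAtomSum.
Variables (R : realType) (X : choiceType) (d : X -> X -> R).
Variables (dO : measure_display) (Om : measurableType dO) (M : Om -> X -> nat).
Hypothesis Mpp : point_process d M.

(** A point process only provides measurable masses of Borel sets. Scaled sums of indicators of
    level sets approximate [h] uniformly on [A], and each configuration has finitely many atoms
    there, so the atom sums converge pointwise. *)
Lemma measurable_atom_sum (A : set X) (h : X -> R) (C : nat) :
  (forall w, finite_set (A `&` [set a | (0 < M w a)%N])) ->
  (forall a, A a -> 0 <= h a <= C%:R) ->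
  (forall t : R, mborel d (A `&` [set a | t <= h a])) ->
  measurable_fun setT (fun w => atom_sum (M w) A h).
Proof.
move=> Af hC hB.
pose lev n j := A `&` [set a | j.+1%:R / n.+1%:R <= h a].
pose hn n a : R := n.+1%:R^-1 * \sum_(j < (C * n.+1)%N) (\1_(lev n j) a : R).
apply: (@measurable_fun_cvg _ _ _ _ (fun n w => atom_sum (M w) A (hn n))).
  move=> n.
  rewrite (_ : (fun w => _) = (fun w => n.+1%:R^-1 *
    \sum_(j < (C * n.+1)%N) atom_sum (M w) A \1_(lev n j))); last first.
    by apply/funext => w; rewrite atom_sumZ// atom_sum_sum.
  apply: measurable_funM => //; apply: measurable_sum => j.
  apply/measurable_EFinP.
  rewrite (_ : EFin \o _ = (fun w => mass R (M w) (lev n j))).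
    by apply: Mpp.2; exact: hB.
  by apply/funext => w; rewrite (mass_atom_sum R (Af w))// => a [].
move=> w _; apply/cvgrPdist_le => e e0.
pose c : R := atom_sum (M w) A (cst 1).
have c0 : 0 <= c by apply: atom_sum_ge0.
(* The [+ 1] keeps the denominator positive when there is no atom in [A]. *)
have : \forall n \near \oo, n.+1%:R^-1 < e / (c + 1).
  have /cvgr_lt := @cvg_harmonic R; apply; rewrite divr_gt0//; lra.
apply: filterS => n ne.
have := @atom_sum_dist R X (M w) A h (hn n) n.+1%:R^-1 (Af w); rewrite -/c => hd.
apply: le_trans (hd _) _; last first.
  have : n.+1%:R^-1 * c <= e / (c + 1) * c by rewrite ler_wpM2r// ltW.
  move=> /le_trans; apply; rewrite mulrAC ler_pdivrMr; last by lra.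
  by rewrite ler_pM2l//; lra.
move=> a Aa; have /andP[ha0 haC] := hC a Aa.
have n0 : 0 < n.+1%:R :> R by rewrite ltr0n.
rewrite /hn (_ : \sum_(j < _) _ =
    \sum_(j < (C * n.+1)%N) ((j.+1%:R <= n.+1%:R * h a)%R%:R : R)); last first.
  apply: eq_bigr => j _; rewrite indicE; congr (_ %:R); congr nat_of_bool.
  rewrite (mulrC _ (h a)) -ler_pdivrMr//; apply/idP/idP.
    by rewrite inE => -[].
  by move=> jh; rewrite inE; split.
have -> : h a = n.+1%:R^-1 * (n.+1%:R * h a) by rewrite mulrA mulVf ?mul1r// gt_eqF.
rewrite mulVKf ?gt_eqF// -mulrBr normrM ger0_norm ?invr_ge0//.
rewrite -[leRHS]mulr1 ler_pM2l ?invr_gt0//; apply: count_le_approx.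
by rewrite mulr_ge0//= natrM mulrC ler_pM2r.
Qed.

End MeasurableAtomSum.

(** * Test functions *)

Section TestFunctions.
Variables (R : realType) (X : choiceType) (d : X -> X -> R) (x : X) (r : R).
Hypotheses (dm : is_metric d) (dp : proper_metric d).
Implicit Types phi psi : X -> R.

(** Nonnegativity keeps the exponential of minus an atom sum at most 1. Vanishing beyond a radius
    [rho < r] is stable under sums and, by properness, gives compact support in the open ball. *)
Definition test_function phi : Prop :=
  [/\ forall y, 0 <= phi y, exists C : nat, forall y, phi y <= C%:R,
      mcont_on d (@Rdist R) setT phi &
      exists2 rho : R, rho < r & forall y, rho < d x y -> phi y = 0].

Lemma test_function0 : test_function (fun=> 0).
Proof.
split=> //; first by exists 0%N.
- by move=> y _ e e0; exists 1 => // z _ _; rewrite /Rdist subrr normr0.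
- by exists (r - 1) => //; rewrite ltrBlDr ltrDl.
Qed.

Lemma test_functionD phi psi : test_function phi -> test_function psi ->
  test_function (fun y => phi y + psi y).
Proof.
move=> [p0 [C pC] pc [rho rr prho]] [q0 [C' qC] qc [rho' rr' qrho]]; split.
- by move=> y; rewrite addr_ge0.
- by exists (C + C')%N => y; rewrite natrD lerD.
- move=> y _ e e0; have e2 : 0 < e / 2 by rewrite divr_gt0.
  have [a a0 ap] := pc y I _ e2; have [b b0 bq] := qc y I _ e2.
  exists (Num.min a b); first by rewrite lt_min a0.
  move=> z _; rewrite lt_min => /andP[/(ap z I) + /(bq z I)].
  rewrite /Rdist => h1 h2.
  rewrite (_ : _ - _ = (phi y - phi z) + (psi y - psi z)); last by ring.
  by apply: (le_lt_trans (ler_normD _ _)); lra.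
- exists (Num.max rho rho'); first by rewrite gt_max rr.
  by move=> y; rewrite gt_max => /andP[/prho -> /qrho ->]; rewrite addr0.
Qed.

Lemma test_function_compact phi : test_function phi ->
  compactly_supported_in d phi (oball d x r).
Proof.
move=> [_ _ _ [rho rr prho]].
have sub : msupport d phi `<=` cball d x rho.
  move=> y ys; rewrite /cball /= leNgt; apply/negP => xy.
  have [|z] := ys (d x y - rho); first by rewrite subr_gt0.
  move=> /negP nz yz; apply: nz; apply/eqP/prho.
  by have := dist_tri dm x z y; rewrite (dist_sym dm z y); lra.
split; last by move=> y /sub; rewrite /cball /oball /= => /le_lt_trans; apply.
suff : mopen d (~` msupport d phi) by exact: (mcompact_closed (@dp x rho) sub).
move=> y /= ny.
have [e ne] : exists e, ~ (0 < e -> exists2 z, phi z != 0 & d y z < e).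
  by apply/existsNP.
have [e0 {}ne] : 0 < e /\ ~ (exists2 z, phi z != 0 & d y z < e) by apply/not_implyP.
exists e => // z; rewrite /oball /= => yz zs.
have [|u uz zu] := zs (e - d y z); first by rewrite subr_gt0.
by apply: ne; exists u => //; have := dist_tri dm y z u; lra.
Qed.

(** For [s < t], a Urysohn cutoff: 1 on the closed ball of radius [s], and positive exactly on the
    open ball of radius [t]. *)
Definition tent (c : X) (s t : R) (y : X) : R :=
  Num.max 0 (Num.min 1 ((t - d c y) / (t - s))).

Lemma tent_ge0 c s t y : 0 <= tent c s t y.
Proof. by rewrite /tent le_max lexx. Qed.

Lemma tent_le1 c s t y : tent c s t y <= 1.
Proof. by rewrite /tent ge_max ler01 ge_min lexx. Qed.

Lemma tent_eq1 c s t y : s < t -> d c y <= s -> tent c s t y = 1.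
Proof.
move=> st cy; rewrite /tent min_l; first by rewrite max_r.
by rewrite ler_pdivlMr ?subr_gt0// mul1r; lra.
Qed.

Lemma tent_eq0 c s t y : s < t -> t <= d c y -> tent c s t y = 0.
Proof.
move=> st cy; rewrite /tent max_l// ge_min.
by rewrite ler_pdivrMr ?subr_gt0// mul0r subr_le0 cy orbT.
Qed.

Lemma tent_gt0 c s t y : s < t -> d c y < t -> 0 < tent c s t y.
Proof.
move=> st cy; rewrite /tent lt_max lt_min ltr01 /=.
by rewrite divr_gt0 ?orbT// subr_gt0.
Qed.

Lemma test_function_tent c s t : s < t -> d x c + t < r ->
  test_function (tent c s t).
Proof.
move=> st ctr; split.
- by move=> y; exact: tent_ge0.
- by exists 1%N => y; exact: tent_le1.
- move=> y _ e e0; exists (e * (t - s)); first by rewrite mulr_gt0// subr_gt0.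
  move=> z _ yz; rewrite /Rdist /tent.
  set a := (t - d c y) / (t - s); set b := (t - d c z) / (t - s).
  have ab : `|a - b| < e.
    rewrite /a /b -mulrBl normrM (gtr0_norm (x := (t - s)^-1)); last first.
      by rewrite invr_gt0 subr_gt0.
    rewrite ltr_pdivrMr ?subr_gt0//; apply: le_lt_trans yz.
    have := dist_tri dm c y z; have := dist_tri dm c z y.
    by rewrite (dist_sym dm z y) ler_norml; lra.
  (* Truncation to the unit interval does not increase distances. *)
  move: ab; rewrite !ltr_norml.
  by case: (leP 1 a) => a1; case: (leP 1 b) => b1; rewrite ?(max_r ler01);
    case: (leP 0 a) => ?; case: (leP 0 b) => ?; lra.
- exists (d x c + t) => // y cy; apply: tent_eq0 => //.
  by have := dist_tri dm x c y; lra.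
Qed.

End TestFunctions.

(** [f] is continuous on the closed ball only; still, the trace on that ball of a superlevel set of
    [phi] composed with [f] is closed, hence Borel. *)
Lemma measurable_pullback_atom_sum (R : realType) (X X' : choiceType)
    (d : X -> X -> R) (x : X) (d' : X' -> X' -> R) (x' : X') (r : R) (f : X -> X')
    (dO : measure_display) (Om : measurableType dO) (M : Om -> X -> nat) phi :
  is_metric d -> point_process d M -> mcont_on d d' (cball d x r) f ->
  test_function d' x' r phi ->
  measurable_fun setT (fun w => atom_sum (M w) (cball d x r) (fun a => phi (f a))).
Proof.
move=> dm Mpp fc [p0 [C pC] pc _].
apply: (@measurable_atom_sum R X d _ _ M Mpp _ _ C).
- by move=> w; exact: Mpp.1.
- by move=> a _; rewrite p0 pC.
- move=> t; apply: mborel_setC; rewrite setCI => y.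
  have [Ky|/(mopenC_cball dm)[e e0 eK]] := pselect (cball d x r y); last first.
    by move=> _; exists e => // z /eK; left.
  move=> [//|/negP]; rewrite -ltNge => yt.
  have [e e0 eP] := pc (f y) I (t - phi (f y)) ltac:(by rewrite subr_gt0).
  have [e' e'0 e'P] := fc y Ky e e0.
  exists e' => // z yz; have [Kz|nKz] := pselect (cball d x r z); last by left.
  right; apply/negP; rewrite -ltNge.
  by have := eP _ I (e'P z Kz yz); rewrite /Rdist ltr_norml; lra.
Qed.

(** * The algebra of exponential functionals *)

Section ExponentialAlgebra.
Variables (R : realType) (X : Type) (test : set (X -> R)).
Hypotheses (test0 : test (fun=> 0))
  (testD : forall phi psi, test phi -> test psi -> test (fun y => phi y + psi y)).
Implicit Types (Lam : (X -> R) -> R) (F G : ((X -> R) -> R) -> R).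

(** The model is integration against a configuration. Additivity is what makes a product of two
    exponentials a single exponential. *)
Definition additive_functional Lam : Prop :=
  Lam (fun=> 0) = 0 /\
  (forall phi psi, Lam (fun y => phi y + psi y) = Lam phi + Lam psi).

(* Linear combinations of the functionals [Lam |-> expR (- Lam phi)]: they form
   an algebra, which is what lets one-dimensional convergence in law control
   events that involve several test functions at once. *)
Inductive expalg : (((X -> R) -> R) -> R) -> Prop :=
| Expalg_nil F : (forall Lam, additive_functional Lam -> F Lam = 0) -> expalg F
| Expalg_cons F c phi G : test phi -> expalg G ->
    (forall Lam, additive_functional Lam -> F Lam = c * expR (- Lam phi) + G Lam) ->
    expalg F.

Lemma expalgD F G : expalg F -> expalg G -> expalg (fun Lam => F Lam + G Lam).
Proof.
move=> Fe Ge; elim: Fe => {F} [F F0|F c phi H tphi _ IH FE].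
  case: Ge => [{}G G0|{}G c phi H tphi He GE].
    by apply: Expalg_nil => Lam aL; rewrite F0// G0// addr0.
  by apply: (Expalg_cons tphi He) => Lam aL; rewrite F0// GE// add0r.
by apply: (Expalg_cons tphi IH) => Lam aL; rewrite FE// addrA.
Qed.

Lemma expalg_exp phi : test phi -> expalg (fun Lam => expR (- Lam phi)).
Proof.
move=> tphi; apply: (@Expalg_cons _ 1 phi (fun=> 0) tphi).
  exact: Expalg_nil.
by move=> Lam _; rewrite mul1r addr0.
Qed.

Lemma expalg_cst c : expalg (fun=> c).
Proof.
apply: (@Expalg_cons _ c (fun=> 0) (fun=> 0) test0); first exact: Expalg_nil.
by move=> Lam [-> _]; rewrite oppr0 expR0 mulr1 addr0.
Qed.

Lemma eq_expalg F G :
  (forall Lam, additive_functional Lam -> F Lam = G Lam) -> expalg G -> expalg F.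
Proof.
move=> FG Ge; case: Ge FG => {G} [G G0|G c phi H tphi He GE] FG.
  by apply: Expalg_nil => Lam aL; rewrite FG// G0.
by apply: (Expalg_cons tphi He) => Lam aL; rewrite FG// GE.
Qed.

Lemma expalgM F G : expalg F -> expalg G -> expalg (fun Lam => F Lam * G Lam).
Proof.
move=> Fe Ge; elim: Fe => {F} [F F0|F c phi H tphi _ IH FE].
  by apply: Expalg_nil => Lam aL; rewrite F0// mul0r.
(* The inner induction runs over the second factor, one exponential term at a time, and carries
   along [H Lam * G Lam], already known to be in the algebra. *)
suff mono K : expalg K ->
    expalg (fun Lam => c * expR (- Lam phi) * K Lam + H Lam * G Lam).
  by apply: eq_expalg (mono _ Ge) => Lam aL; rewrite FE// mulrDl.
elim=> {K} [K K0|K c' psi K' tpsi _ IHK KE].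
  by apply: eq_expalg IH => Lam aL; rewrite K0// mulr0 add0r.
apply: (@Expalg_cons _ (c * c') _ _ (testD tphi tpsi) IHK) => Lam aL.
by rewrite KE// aL.2 opprD expRD; ring.
Qed.

Lemma expalgX F n : expalg F -> expalg (fun Lam => F Lam ^+ n).
Proof.
move=> Fe; elim: n => [|n IH]; first exact: (expalg_cst 1).
have := expalgM Fe IH; congr expalg; apply/funext => Lam.
by rewrite exprS.
Qed.

Lemma expalg1B F : expalg F -> expalg (fun Lam => 1 - F Lam).
Proof.
move=> /(expalgM (expalg_cst (-1)))/(expalgD (expalg_cst 1)); congr expalg.
by apply/funext => Lam; rewrite mulN1r.
Qed.

Lemma expalg_prod I (s : seq I) (F : I -> ((X -> R) -> R) -> R) :
  (forall i, expalg (F i)) -> expalg (fun Lam => \prod_(i <- s) F i Lam).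
Proof.
move=> Fe; elim: s => [|i s IH].
  by have := expalg_cst 1; congr expalg; apply/funext => Lam; rewrite big_nil.
have := expalgM (Fe i) IH; congr expalg; apply/funext => Lam.
by rewrite big_cons.
Qed.

Lemma expalg_bounded_measurable (dO : measure_display) (Om : measurableType dO)
    (Lam : Om -> (X -> R) -> R) F :
  (forall w, additive_functional (Lam w)) ->
  (forall phi, test phi -> measurable_fun setT (Lam ^~ phi)) ->
  (forall phi w, test phi -> 0 <= Lam w phi) ->
  expalg F ->
  measurable_fun setT (fun w => F (Lam w)) /\ exists C, forall w, `|F (Lam w)| <= C.
Proof.
move=> aL mL L0; elim=> {F} [F F0|F c phi G tphi _ [mG [C GC]] FE].
  split; last by exists 0 => w; rewrite F0// normr0.
  by rewrite (_ : (fun w => _) = cst 0)//; apply/funext => w; rewrite F0.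
split.
  rewrite (_ : (fun w => _) = (fun w => c * expR (- Lam w phi) + G (Lam w))).
    apply: measurable_funD => //; apply: measurable_funM => //.
    apply: measurableT_comp => //; apply: measurableT_comp => //; exact: mL.
  by apply/funext => w; rewrite FE.
exists (`|c| + C) => w; rewrite FE// (le_trans (ler_normD _ _))// lerD//.
rewrite normrM -[leRHS]mulr1 ler_wpM2l// ger0_norm ?expR_ge0// expR_le1.
by rewrite oppr_le0 L0.
Qed.

End ExponentialAlgebra.

(** * Lower semicontinuity of probabilities *)

(** If the [a j] are probabilities of independent events, the expression is the probability of their
    union, whence the bounds. Being a polynomial, it plays the part of a union inside the
    algebra. *)
Lemma union_bound_prod (R : realType) (n : nat) (a : nat -> R) :
  (forall j, (j < n)%N -> 0 <= a j <= 1) ->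
  [/\ 0 <= 1 - \prod_(j < n) (1 - a j) <= 1,
      1 - \prod_(j < n) (1 - a j) <= \sum_(j < n) a j &
      forall j, (j < n)%N -> a j <= 1 - \prod_(j < n) (1 - a j)].
Proof.
elim: n => [|n IH] a01.
  by rewrite !big_ord0; split=> //; lra.
have [j jn|/andP[p0 p1] ps pj] := IH; first by apply: a01; rewrite ltnS ltnW.
have /andP[an0 an1] := a01 n (ltnSn n).
rewrite !big_ord_recr /=; set p := \prod_(_ < _) _ in p0 p1 ps pj *.
have q0 : 0 <= p * (1 - a n) by rewrite mulr_ge0//; lra.
have q1 : p * (1 - a n) <= p by rewrite ler_piMr//; lra.
have q2 : p * (1 - a n) <= 1 - a n by rewrite ler_piMl//; lra.
split.
- by lra.
- apply: le_trans (lerD ps (lexx (a n))).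
  rewrite mulrBr mulr1; have : p * a n <= a n by rewrite ler_piMl//; lra.
  lra.
- move=> j; rewrite ltnS leq_eqVlt => /predU1P[->|/pj]; first by lra.
  by move=> ?; lra.
Qed.

(** By the quadratic lower bound on the exponential. This controls the total error of [J.+1]
    functionals that are each off by [expR (- J.+1%:R)]. *)
Lemma mulr_expRN_le (R : realType) (J : nat) :
  J.+1%:R * expR (- J.+1%:R) <= 2 / J.+1%:R :> R.
Proof.
have J0 : 0 < J.+1%:R :> R by [].
have := @expR_ge1Dxn R J.+1%:R 1 (ltW J0); rewrite expRN => h.
rewrite ler_pdivrMr ?expR_gt0// mulrAC ler_pdivlMr//.
move: h; rewrite -expr2; set y := J.+1%:R ^+ 2; rewrite (_ : 2`! = 2%N)//; lra.
Qed.

Section LowerSemicontinuity.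
Variables (R : realType) (X : Type) (test : set (X -> R)).
Hypotheses (test0 : test (fun=> 0))
  (testD : forall phi psi, test phi -> test psi -> test (fun y => phi y + psi y)).

Lemma expalg_integrable (dO : measure_display) (Om : measurableType dO)
    (P : probability Om R) (Lam : Om -> (X -> R) -> R) F :
  (forall w, additive_functional (Lam w)) ->
  (forall phi, test phi -> measurable_fun setT (Lam ^~ phi)) ->
  (forall w phi, test phi -> 0 <= Lam w phi) ->
  expalg test F -> P.-integrable setT (EFin \o (fun w => F (Lam w))).
Proof.
move=> aL mL L0 Fe.
have [|mF [C FC]] := expalg_bounded_measurable aL mL _ Fe.
  by move=> phi w; exact: L0.
apply: measurable_bounded_integrable => //.
  exact: le_lt_trans (probability_le1 P measurableT) (ltry 1).
exists C; split; first by rewrite num_real.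
by move=> C' CC' w _; exact: le_trans (FC w) (ltW CC').
Qed.

Variables (dO : nat -> measure_display) (Om : forall N, measurableType (dO N))
  (P : forall N, probability (Om N) R) (Lam : forall N, Om N -> (X -> R) -> R).
Variables (dO' : measure_display) (Om' : measurableType dO')
  (P' : probability Om' R) (Lam' : Om' -> (X -> R) -> R).
Variable N0 : nat.
Hypothesis aL : forall N w, additive_functional (@Lam N w).
Hypothesis aL' : forall w, additive_functional (Lam' w).
Hypothesis mL : forall N, (N0 <= N)%N -> forall phi, test phi ->
  measurable_fun setT (fun w => @Lam N w phi).
Hypothesis mL' : forall phi, test phi -> measurable_fun setT (Lam' ^~ phi).
Hypothesis L0 : forall N w phi, test phi -> 0 <= @Lam N w phi.
Hypothesis L0' : forall w phi, test phi -> 0 <= Lam' w phi.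
Hypothesis law : forall phi, test phi ->
  cvg_law P (fun N w => @Lam N w phi) P' (fun w => Lam' w phi).

(** By linearity only single exponentials matter, and these depend on the one real variable
    [Lam phi], which converges in law. *)
Lemma expalg_cvg F : expalg test F ->
  (fun N => \int[P N]_w F (@Lam N w)) @ \oo --> \int[P']_w F (Lam' w).
Proof.
elim=> {F} [F F0|F c phi G tphi Ge IH FE].
  rewrite (_ : (fun N => _) = cst 0).
    rewrite (_ : \int[P']_w _ = 0); first exact: cvg_cst.
    by under eq_Rintegral do rewrite F0//; rewrite Rintegral_cst// mul0r.
  apply/funext => N; under eq_Rintegral do rewrite F0//.
  by rewrite Rintegral_cst// mul0r.
have expe := expalg_exp tphi.
have split (d1 : measure_display) (O1 : measurableType d1) (P1 : probability O1 R)
    (L1 : O1 -> (X -> R) -> R) :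
    (forall w, additive_functional (L1 w)) ->
    (forall phi, test phi -> measurable_fun setT (L1 ^~ phi)) ->
    (forall w phi, test phi -> 0 <= L1 w phi) ->
    \int[P1]_w F (L1 w) =
    c * \int[P1]_w expR (- L1 w phi) + \int[P1]_w G (L1 w).
  move=> a1 m1 p1.
  have i1 := expalg_integrable P1 a1 m1 p1 expe.
  have i2 := expalg_integrable P1 a1 m1 p1 Ge.
  rewrite -RintegralZl// -RintegralD//.
    by apply: eq_Rintegral => w _; rewrite FE.
  exact: (integrableZl measurableT c i1).
rewrite split//.
have ev : \forall N \near \oo, c * \int[P N]_w expR (- @Lam N w phi) +
    \int[P N]_w G (@Lam N w) = \int[P N]_w F (@Lam N w).
  exists N0 => // N N0N; rewrite split//; [move=> psi tpsi; exact: mL|exact: L0].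
apply: cvg_trans (near_eq_cvg ev) _.
apply: cvgD => //; apply: cvgMr.
(* [expR (- s)] is unbounded for negative [s]; the absolute value repairs this and changes nothing
   on the nonnegative atom sums. *)
have := law tphi (h := fun s => expR (- `|s|)).
have hc : continuous (fun s : R => expR (- `|s|)).
  move=> s; apply: continuous_comp; last exact: continuous_expR.
  by apply: cvgN; exact: norm_continuous.
have hb : exists C : R, forall t : R, `|expR (- `|t|)| <= C.
  by exists 1 => u; rewrite ger0_norm ?expR_ge0// expR_le1 oppr_le0.
move=> /(_ hc hb) {hc hb}.
have fin' : (\int[P']_w (expR (- `|Lam' w phi|))%:E)%E \is a fin_num.
  apply: (@integrable_fin_num _ _ _ P' setT _ _) => //.
  have := expalg_integrable P' aL' mL' L0' expe; congr (_.-integrable _ _).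
  by apply/funext => w /=; rewrite ger0_norm// L0'.
rewrite -(fineK fin') => /fine_cvg.
have -> : (fun N => \int[P N]_w expR (- @Lam N w phi)) =
    fine \o (fun N => (\int[P N]_w (expR (- `|@Lam N w phi|))%:E)%E).
  apply/funext => N /=; rewrite /Rintegral; congr fine.
  by apply: eq_integral => w _; rewrite ger0_norm// L0.
rewrite (_ : \int[P']_w _ = fine (\int[P']_w (expR (- `|Lam' w phi|))%:E)%E)//.
rewrite /Rintegral; congr fine.
by apply: eq_integral => w _; rewrite ger0_norm// L0'.
Qed.

Variables (T : forall N, set (Om N)) (T' : set Om').
Hypothesis mT : forall N, measurable (@T N).
Hypothesis mT' : measurable T'.
Variable F : nat -> nat -> ((X -> R) -> R) -> R.
Hypothesis Fe : forall j l, expalg test (F j l).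
Hypothesis F01 : forall j l N w, 0 <= F j l (@Lam N w) <= 1.
Hypothesis F01' : forall j l w, 0 <= F j l (Lam' w) <= 1.
Hypothesis FT : forall j, \forall N \near \oo, forall l w, ~ @T N w ->
  F j l (@Lam N w) <= expR (- l%:R).
Hypothesis FT' : {ae P', forall w, T' w ->
  exists j, (fun l => F j l (Lam' w)) @ \oo --> (1 : R)}.

(** A smoothed union [G J] of finitely many functionals tends to 1 almost surely on [T'], so its
    mean nearly reaches the probability of [T']. The mean passes to the limit in [N], and off [T N]
    the value of [G J] is small. Each of the three steps costs [e / 4]. *)
Lemma liminf_probability (e : R) : 0 < e ->
  \forall N \near \oo, fine (P' T') - e <= fine (P N (@T N)).
Proof.
move=> e0.
(* One index [J] sets both the number of functionals and their sharpness, so a single limit sends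
   [G J] to 1 on [T'] and its error bound off [T N] to 0. *)
pose G J L := 1 - \prod_(j < J.+1) (1 - F j J.+1 L).
have Ge J : expalg test (G J).
  apply: expalg1B => //; rewrite /index_enum; apply: expalg_prod => // j.
  exact: expalg1B.
have G01' J w : 0 <= G J (Lam' w) <= 1.
  by have [] := @union_bound_prod R J.+1 (fun j => F j J.+1 (Lam' w)).
have int' J := expalg_integrable P' aL' mL' L0' (Ge J).
have cvgG : {ae P', forall w, T' w -> (fun J => (G J (Lam' w))%:E) @ \oo --> 1%:E}.
  apply: filterS FT' => w + T'w => /(_ T'w)[j Fj].
  apply: cvg_EFin; first by apply: nearW.
  apply: (@squeeze_cvgr _ _ _ _ (fun J => F j J.+1 (Lam' w)) (cst 1)).
  - exists j => // J /= jJ.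
    have [] := @union_bound_prod R J.+1 (fun j => F j J.+1 (Lam' w)) => //.
    by move=> /andP[_ h1] _ /(_ j); rewrite ltnS => /(_ jJ) ->.
  - by rewrite (cvg_shiftS (fun J => F j J (Lam' w))).
  - exact: cvg_cst.
have cvgI : (fun J => \int[P']_(w in T') (G J (Lam' w))%:E)%E @ \oo --> P' T'.
  have [||||| _ _] := @dominated_convergence _ _ _ P' T' mT'
    (fun J w => (G J (Lam' w))%:E) (cst 1%E) (cst 1%E).
  - move=> J; apply: measurable_funTS.
    by have /measurable_int := int' J.
  - exact: measurable_cst.
  - exact: cvgG.
  - apply: (@integrableS _ _ _ _ setT) => //.
    apply: (@measurable_bounded_integrable _ _ _ _ (cst 1)) => //.
      exact: le_lt_trans (probability_le1 P' measurableT) (ltry 1).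
    by exists 1; split => // C C1 w _ /=; rewrite normr1 ltW.
  - apply: aeW => w J _; rewrite lee_fin /=; have /andP[h1 h2] := G01' J w.
    by rewrite ger0_norm.
  - by rewrite integral_cst// mul1e.
have PT'f : P' T' \is a fin_num by rewrite fin_num_measure.
have /filter_ex[J [IJ eJ]] : \forall J \near \oo,
    fine (P' T') - e / 4 < fine (\int[P']_(w in T') (G J (Lam' w))%:E)%E /\
    2 / J.+1%:R < e / 4.
  apply: filterI.
    have /fine_cvg : (fun J => \int[P']_(w in T') (G J (Lam' w))%:E)%E @ \oo -->
      (fine (P' T'))%:E by rewrite fineK.
    by move=> /cvgr_gt; apply; lra.
  have /cvgr_lt : (fun J : nat => 2 * J.+1%:R^-1 : R) @ \oo --> (2 * 0 : R).
    by apply: cvgMr; exact: cvg_harmonic.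
  by apply; rewrite mulr0; lra.
have {}IJ : fine (P' T') - e / 4 < \int[P']_w G J (Lam' w).
  apply: (lt_le_trans IJ); apply: fine_le.
  - apply: (@integrable_fin_num _ _ _ P' T') => //.
    exact: (integrableS measurableT mT' (@subsetT _ _) (int' J)).
  - exact: (integrable_fin_num measurableT (int' J)).
  - apply: ge0_subset_integral => //; first by have /measurable_int := int' J.
    by move=> w _; rewrite lee_fin; have /andP[] := G01' J w.
have evG : \forall N \near \oo, fine (P' T') - e / 2 < \int[P N]_w G J (@Lam N w).
  by have /cvgr_gt := expalg_cvg (Ge J); apply; lra.
(* The thresholds in [N] depend on [j]; with [J] fixed, only finitely many are involved. *)
have evF : \forall N \near \oo, forall j, (j < J.+1)%N -> forall l w, ~ @T N w ->
    F j l (@Lam N w) <= expR (- l%:R).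
  elim: J.+1 => [|n IHn]; first exact: nearW.
  apply: filterS2 IHn (FT n) => N h1 h2 j; rewrite ltnS leq_eqVlt.
  by move=> /predU1P[->//|/h1].
have evN : \forall N \near \oo, (N0 <= N)%N by exact: nbhs_infty_ge.
apply: filterS3 evG evF evN => N GN FN N0N.
have intN := expalg_integrable (P N) (aL (N:=N)) (mL N0N) (L0 (N:=N)) (Ge J).
suff : \int[P N]_w G J (@Lam N w) <= fine (P N (@T N)) + e / 4 by lra.
have intT : (P N).-integrable setT (EFin \o (fun w => \1_(@T N) w + e / 4 : R)).
  apply: measurable_bounded_integrable => //.
  - exact: le_lt_trans (probability_le1 (P N) measurableT) (ltry 1).
  - exact: measurable_funD.
  - exists (1 + e / 4); split; first by rewrite num_real.
    move=> C C1 w _; apply: le_trans (ltW C1).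
    by rewrite indicE; case: (_ \in _); rewrite /= ?mulr1n ?mulr0n ger0_norm; lra.
have -> : fine (P N (@T N)) + e / 4 = \int[P N]_w (\1_(@T N) w + e / 4).
  rewrite RintegralD//; first last.
  - exact: finite_measure_integrable_cst.
  - exact: integrable_indic.
  - rewrite Rintegral_cst// [X in _ * fine X](probability_setT (P N)) mulr1 /Rintegral.
    by rewrite integral_indic// setIT.
apply: fine_le; try exact: (@integrable_fin_num _ _ _ (P N) setT).
apply: le_integral => // w _; rewrite lee_fin.
have [j _|/andP[g0 g1] gs _] := @union_bound_prod R J.+1 (fun j => F j J.+1 (@Lam N w)).
  exact: F01.
rewrite /= in g0 g1 gs; rewrite indicE; have [Tw|nTw] := boolP (w \in @T N).
  by rewrite /G /=; lra.
rewrite /= mulr0n add0r; apply: le_trans gs _; apply: le_trans (ltW eJ).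
apply: le_trans (mulr_expRN_le R J).
rewrite notin_setE in nTw.
apply: (@le_trans _ _ (\sum_(j < J.+1) expR (- J.+1%:R))).
  by apply: ler_sum => j _; apply: FN.
by rewrite sumr_const card_ord mulr_natl.
Qed.

End LowerSemicontinuity.

(** * Functionals that detect a pattern of atoms *)

Section CountFunctional.
Variables (R : realType) (X' : choiceType) (d' : X' -> X' -> R) (x' : X').
Hypothesis dm' : is_metric d'.
Variables (D : nat -> X') (c : seq nat) (eps rho th : R).

(* Up to an error [expR (- l)], this detects that each of the [size c] disjoint
   balls of radius [eps] carries exactly one atom and that there is no other atom
   within [rho + th] of [x']: the middle factor vanishes if a ball is missed, and
   otherwise the total mass is at least [size c]. *)
Definition count_functional (l : nat) (Lam : (X' -> R) -> R) : R :=
  expR (l%:R * (size c)%:R) *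
  (\prod_(i <- c) (1 - expR (- Lam (tent d' (D i) 0 eps)) ^+ l) *
   expR (- Lam (tent d' x' (rho + th) (rho + th + th))) ^+ l).

(** Spacing [2 * eps] makes the open balls disjoint, so they carry distinct atoms; the bound by
    [rho + th] places them where the wide cutoff equals 1. *)
Definition separated_centers : Prop :=
  [/\ 0 < eps, 0 < th, uniq c,
      forall i, i \in c -> d' x' (D i) + eps <= rho + th &
      forall i j, i \in c -> j \in c -> i <> j -> 2 * eps <= d' (D i) (D j)].

Lemma expalg_count_functional (r : R) (l : nat) :
  separated_centers -> rho + th + th < r ->
  expalg (test_function d' x' r) (count_functional l).
Proof.
move=> [e0 th0 uc cb _] rr.
have t0 := @test_function0 R X' d' x' r.
have tD := @test_functionD R X' d' x' r.
apply: expalgM => //; first exact: expalg_cst.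
apply: expalgM => //; last first.
  apply: expalgX => //; apply: expalg_exp; apply: test_function_tent => //.
    by rewrite ltrDl.
  by rewrite (dist_eq0 dm' x' x').2// add0r.
(* The tent at [D i] is known to be a test function only for [i] in [c], hence an induction on
   sublists instead of [expalg_prod]. *)
have prod s : {subset s <= c} -> expalg (test_function d' x' r)
    (fun Lam => \prod_(i <- s) (1 - expR (- Lam (tent d' (D i) 0 eps)) ^+ l)).
  elim: s => [|i s IH] sc.
    by apply: eq_expalg (expalg_cst t0 1) => Lam _; rewrite big_nil.
  apply: (eq_expalg (G := fun Lam => (1 - expR (- Lam (tent d' (D i) 0 eps)) ^+ l) *
    \prod_(i <- s) (1 - expR (- Lam (tent d' (D i) 0 eps)) ^+ l))).
    by move=> Lam _; rewrite big_cons.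
  apply: expalgM => //; last by apply: IH => j js; apply: sc; rewrite in_cons js orbT.
  apply: expalg1B => //; apply: expalgX => //; apply: expalg_exp.
  apply: test_function_tent => //.
  by have := cb i (sc _ (mem_head i s)); lra.
exact: prod.
Qed.

Variables (X : choiceType) (x0 : X) (m : X -> nat) (A : set X) (f : X -> X').
Hypothesis Af : finite_set (A `&` [set a | (0 < m a)%N]).
Let Lam (phi : X' -> R) := atom_sum m A (fun a => phi (f a)).

Definition one_atom_per_ball (a : nat -> X) : Prop :=
  (forall i, i \in c -> [/\ A (a i), (0 < m (a i))%N & d' (D i) (f (a i)) < eps]) /\
  (forall b, A b -> (0 < m b)%N -> d' x' (f b) <= rho + th ->
     exists2 i, i \in c & b = a i).

(** The pattern fails either because a ball has no atom, and then a factor vanishes, or because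
    there is an atom besides the chosen ones, which adds 1 to the total mass and so gains
    [expR (- l%:R)]. *)
Lemma count_functional_bounds (l : nat) : separated_centers ->
  0 <= count_functional l Lam <= 1 /\
  ((forall a, ~ one_atom_per_ball a) -> count_functional l Lam <= expR (- l%:R)).
Proof.
move=> [e0 th0 uc cb cs]; rewrite /count_functional.
set psi := tent d' x' _ _.
have Lam0 phi : (forall y, 0 <= phi y) -> 0 <= Lam phi.
  by move=> phi0; apply: atom_sum_ge0 => // a _.
have exp01 phi : (forall y, 0 <= phi y) -> 0 <= expR (- Lam phi) ^+ l <= 1.
  move=> /Lam0 L0; rewrite exprn_ge0 ?expR_ge0//= exprn_ile1 ?expR_ge0//.
  by rewrite expR_le1 oppr_le0.
set p := \prod_(i <- c) _.
have p01 : 0 <= p <= 1.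
  rewrite /p; elim: c => [|i s /andP[IH0 IH1]]; first by rewrite big_nil ler01 lexx.
  rewrite big_cons.
  have /andP[h0 h1] := exp01 _ (@tent_ge0 R X' d' (D i) 0 eps).
  by rewrite mulr_ge0//= ?subr_ge0// mulr_ile1 ?subr_ge0// gerBl.
have /andP[p0 p1] := p01.
have [hit|] := pselect (forall i, i \in c -> exists a,
    [/\ A a, (0 < m a)%N & d' (D i) (f a) < eps]); last first.
  move=> /existsNP[i /not_implyP[ic /forallNP ni]].
  have Li : Lam (tent d' (D i) 0 eps) = 0.
    rewrite /Lam atom_sumE// big1_seq// => a /andP[_].
    rewrite in_fset_set// inE => -[Aa ma]; rewrite tent_eq0 ?mulr0// leNgt.
    by apply/negP => ia; apply: (ni a).
  have -> : p = 0.
    by rewrite /p (big_rem i)//= Li oppr0 expR0 expr1n subrr mul0r.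
  by rewrite mul0r mulr0 lexx ler01 expR_ge0.
have [a aP] : exists a : nat -> X, forall i, i \in c ->
    [/\ A (a i), (0 < m (a i))%N & d' (D i) (f (a i)) < eps].
  suff /choice[a aP] : forall i, exists b, i \in c ->
    [/\ A b, (0 < m b)%N & d' (D i) (f b) < eps] by exists a.
  move=> i; have [/hit[b bP]|nic] := boolP (i \in c); first by exists b.
  by exists x0.
have ua : uniq [seq a i | i <- c].
  rewrite map_inj_in_uniq// => i j ic jc aij; apply: contrapT => nij.
  have [_ _ h1] := aP i ic; have [_ _ h2] := aP j jc; rewrite -aij in h2.
  have := cs i j ic jc nij; have := dist_tri dm' (D i) (f (a i)) (D j).
  by rewrite (dist_sym dm' (f (a i)) (D j)); lra.
have psi1 y : d' x' y <= rho + th -> 1 <= psi y.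
  by move=> yr; rewrite /psi tent_eq1// ltrDl.
have psia i : i \in c -> 1 <= psi (f (a i)).
  move=> ic; apply: psi1; have [_ _ h1] := aP i ic; have := cb i ic.
  by have := dist_tri dm' x' (D i) (f (a i)); lra.
(* Used twice: with [n] the size of [c] for the bound by 1, and with one more for the gain from an
   extra atom. *)
have key (n : R) : n <= Lam psi ->
    expR (l%:R * n) * (p * expR (- Lam psi) ^+ l) <= p.
  move=> nL; rewrite mulrCA ler_piMr// -expRM_natl -expRD expR_le1 -mulrDr.
  by rewrite mulr_ge0_le0// subr_le0.
have sL : (size c)%:R <= Lam psi.
  rewrite -(size_map a); apply: atom_sum_ge_size => //.
    by move=> b _; exact: tent_ge0.
  by move=> _ /mapP[i ic ->]; have [h1 h2 _] := aP i ic; split=> //; apply: psia.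
split.
  by rewrite mulr_ge0 ?expR_ge0 ?mulr_ge0 ?exprn_ge0 ?expR_ge0//= (le_trans (key _ sL)).
move=> /(_ a) na.
have [b [Ab mb xb nb]] : exists b, [/\ A b, (0 < m b)%N, d' x' (f b) <= rho + th &
    b \notin [seq a i | i <- c]].
  apply: contrapT => /forallNP nex; apply: na; split => // b Ab mb xb.
  have [/mapP[i ic ->]|nb] := boolP (b \in [seq a i | i <- c]); first by exists i.
  by exfalso; apply: (nex b).
have sL1 : (size c)%:R + 1 <= Lam psi.
  rewrite natr1 -(size_map a) -[_.+1]/(size (b :: [seq a i | i <- c])).
  apply: atom_sum_ge_size => //.
  - by move=> y _; exact: tent_ge0.
  - by rewrite /= nb.
  - move=> y; rewrite in_cons => /orP[/eqP ->|/mapP[i ic ->]].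
      by split=> //; exact: psi1.
    by have [h1 h2 _] := aP i ic; split=> //; apply: psia.
have := key _ sL1; rewrite mulrDr mulr1 expRD => hk.
rewrite -(ler_pM2r (expR_gt0 l%:R)) -expRD addNr expR0.
by apply: le_trans p1; apply: le_trans hk; rewrite mulrAC.
Qed.

(** The upper bound on the mass makes the exponential factors together at least 1, leaving the
    product, each factor of which tends to 1 because its ball holds an atom. *)
Lemma count_functional_cvg1 : separated_centers ->
  (forall l, count_functional l Lam <= 1) ->
  (forall i, i \in c -> exists a, [/\ A a, (0 < m a)%N & d' (D i) (f a) < eps]) ->
  Lam (tent d' x' (rho + th) (rho + th + th)) <= (size c)%:R ->
  (fun l => count_functional l Lam) @ \oo --> (1 : R).
Proof.
move=> [e0 th0 uc cb cs] F1 hit Lpsi.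
apply: (@squeeze_cvgr _ _ _ _ (fun l => \prod_(i <- c)
  (1 - expR (- Lam (tent d' (D i) 0 eps)) ^+ l)) (cst 1)); last exact: cvg_cst.
  apply: nearW => l; rewrite F1 andbT /count_functional mulrCA ler_peMr//.
    rewrite big_seq; apply: prodr_ge0 => i _; rewrite subr_ge0.
    rewrite exprn_ile1 ?expR_ge0// expR_le1 oppr_le0.
    by apply: atom_sum_ge0 => // a _; exact: tent_ge0.
  rewrite -expRM_natl -expRD -[leLHS]expR0 ler_expR -mulrDr.
  by rewrite mulr_ge0// subr_ge0.
have prod s : {subset s <= c} -> (fun l => \prod_(i <- s)
    (1 - expR (- Lam (tent d' (D i) 0 eps)) ^+ l)) @ \oo --> (1 : R).
  elim: s => [|i s IH] sc.
    by rewrite (_ : (fun l => _) = cst 1);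
      [exact: cvg_cst|apply/funext => l; rewrite big_nil].
  rewrite (_ : (fun l => _) = (fun l => (1 - expR (- Lam (tent d' (D i) 0 eps)) ^+ l) *
    \prod_(i <- s) (1 - expR (- Lam (tent d' (D i) 0 eps)) ^+ l))); last first.
    by apply/funext => l; rewrite big_cons.
  rewrite -[X in _ --> X]mulr1; apply: cvgM; last first.
    by apply: IH => j js; apply: sc; rewrite in_cons js orbT.
  rewrite -[X in _ --> X]subr0; apply: cvgB; first exact: cvg_cst.
  apply: cvg_expr; rewrite ger0_norm ?expR_ge0// expR_lt1 oppr_lt0.
  have [a [Aa ma ia]] := hit i (sc _ (mem_head i s)).
  (* Dividing the tent by its value at [a] lets the single atom [a] bound the sum away from 0. *)
  have := @atom_sum_ge_size R X m A
    (fun b => (tent d' (D i) 0 eps (f a))^-1 * tent d' (D i) 0 eps (f b)) [:: a].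
  have ta : 0 < tent d' (D i) 0 eps (f a) by exact: tent_gt0.
  rewrite atom_sumZ// => h; have {}h : 1%:R <= (tent d' (D i) 0 eps (f a))^-1 *
      Lam (tent d' (D i) 0 eps).
    apply: h => //.
      by move=> b _; rewrite mulr_ge0 ?invr_ge0 ?tent_ge0.
    by move=> b; rewrite inE => /eqP ->; rewrite mulVf ?gt_eqF.
  by move: h; rewrite mulrC ler_pdivlMr// mul1r; exact: lt_le_trans.
exact: prod.
Qed.

End CountFunctional.

(** * Patterns seen through almost isometries *)

Lemma dil_le (R : realType) (X Y : Type) (dX : X -> X -> R) (dY : Y -> Y -> R)
    (A : set X) (f : X -> Y) (a : R) u v :
  is_metric dX -> is_metric dY -> dil dX dY A f = a%:E -> A u -> A v ->
  dY (f u) (f v) <= a * dX u v.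
Proof.
move=> mX mY dA Au Av; have [<-|nuv] := pselect (u = v).
  by rewrite (dist_eq0 mY _ _).2// (dist_eq0 mX _ _).2// mulr0.
have uv0 : 0 < dX u v.
  by rewrite lt0r (dist_ge0 mX) andbT; apply/eqP => /(dist_eq0 mX).
rewrite -ler_pdivrMr// -lee_fin -dA; apply: ereal_sup_ubound.
by exists u, v.
Qed.

Lemma norm_ln_le (R : realType) (a t : R) : 0 < a -> 0 < t ->
  `|ln a| <= ln t -> a <= t.
Proof.
by move=> a0 t0 /(le_trans (ler_norm _)); rewrite ler_ln.
Qed.

Section LipschitzLimit.
Variables (R : realType).
Variables (X : nat -> choiceType) (x : forall N, X N) (d : forall N, X N -> X N -> R).
Variables (dO : nat -> measure_display) (Om : forall N, measurableType (dO N))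
  (M : forall N, Om N -> X N -> nat).
Variables (X' : choiceType) (x' : X') (d' : X' -> X' -> R).
Hypotheses (dm : forall N, is_metric (@d N)) (dm' : is_metric d').
Variables (r : R) (N0 : nat) (f : forall N, X N -> X') (g : forall N, X' -> X N).
Hypothesis r0 : 0 < r.
Hypothesis fg : forall N, (N0 <= N)%N ->
  mhomeo (@d N) d' (cball (@d N) (x N) r) (cball d' x' r) (@f N) (@g N).
Hypothesis fdil : forall e : R, 0 < e -> \forall N \near \oo,
  exists a b : R, [/\ 0 < a, 0 < b,
    dil (@d N) d' (cball (@d N) (x N) r) (@f N) = a%:E,
    dil d' (@d N) (cball d' x' r) (@g N) = b%:E &
    `|ln a| + `|ln b| + d' (f (x N)) x' + d (x N) (g N x') < e].

(** Distances inside a ball of radius [r] are at most [2 * r], so a multiplicative distortion by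
    [1 + kap / (2 * r)] is an additive one by [kap]. *)
Lemma lipschitz_distortion (kap : R) : 0 < kap -> \forall N \near \oo,
  d' (f (x N)) x' < kap /\
  forall u v, cball (@d N) (x N) r u -> cball (@d N) (x N) r v ->
    d' (f u) (f v) <= d u v + kap /\ d u v <= d' (f u) (f v) + kap.
Proof.
move=> kap0; pose t := 1 + kap / (2 * r).
have t1 : 1 < t by rewrite ltrDl divr_gt0// mulr_gt0.
have e0 : 0 < Num.min kap (ln t) by rewrite lt_min kap0 ln_gt0.
apply: filterS2 (fdil e0) (nbhs_infty_ge N0) => N [a [b [a0 b0 da db]]] + N0N.
rewrite lt_min => /andP[h1 h2].
have := normr_ge0 (ln a); have := normr_ge0 (ln b).
have := dist_ge0 dm' (f (x N)) x'; have := dist_ge0 (@dm N) (x N) (g N x').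
move=> h3 h4 h5 h6; split; first by lra.
have t0 : 0 < t by lra.
have at' : a <= t by apply: norm_ln_le => //; lra.
have bt : b <= t by apply: norm_ln_le => //; lra.
have [fA gB gf _ _] := fg N0N.
move=> u v Au Av.
have bound (Y : choiceType) (dY : Y -> Y -> R) (y y1 y2 : Y) : is_metric dY ->
    dY y y1 <= r -> dY y y2 <= r -> t * dY y1 y2 <= dY y1 y2 + kap.
  move=> mY yy1 yy2; rewrite mulrDl mul1r lerD2l mulrAC ler_pdivrMr ?mulr_gt0//.
  rewrite ler_pM2l//; have := dist_tri mY y1 y y2; rewrite (dist_sym mY y1 y).
  lra.
split.
  have := dil_le (@dm N) dm' da Au Av => /le_trans; apply.
  apply: le_trans (bound _ _ (x N) u v (@dm N) Au Av).
  by rewrite ler_wpM2r// (dist_ge0 (@dm N)).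
have := dil_le dm' (@dm N) db (fA _ Au) (fA _ Av); rewrite !gf// => /le_trans; apply.
apply: le_trans (bound _ _ x' (f u) (f v) dm' (fA _ Au) (fA _ Av)).
by rewrite ler_wpM2r// (dist_ge0 dm').
Qed.

Variables (L : R) (k : nat) (D : nat -> X').
Hypothesis L0 : 0 < L.
(** The graph ball needs radius [k%:R * L]. The first extra unit absorbs the displacement of atoms,
    and the second, in [r], makes room for the decay of the cutoff. *)
Let rho := k%:R * L + 1.
Hypothesis rE : r = rho + 1.
Hypothesis Dd : forall y (e : R), 0 < e -> exists n, d' (D n) y < e.
Variable Q : Defs.rgraph -> Prop.
Hypothesis Qiso : forall G H, rg_set (rg_root G) -> riso G H -> Q G -> Q H.

(** The parameters range over countable sets, so patterns can be enumerated; no limit configuration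
    is mentioned. *)
Definition good_pattern (c : seq nat) (p q : nat) : Prop :=
  [/\ separated_centers d' x' D c q.+1%:R^-1 rho p.+1%:R^-1,
      rho + p.+1%:R^-1 + p.+1%:R^-1 < r &
      \forall N \near \oo, forall (w : Om N) a,
        one_atom_per_ball d' x' D c q.+1%:R^-1 rho p.+1%:R^-1 (M w)
          (cball (@d N) (x N) r) (@f N) a ->
        Q (rball (Gamma_geom (@d N) (x N) (M w) L) k)].

(** The pattern puts one small ball around each atom within [rho]. Matching atoms through it
    distorts distances by less than the margin [del] of [regular_stable], so [geom_ball_riso]
    transports the graph ball. *)
Lemma good_pattern_cover (m' : X' -> nat) :
  locally_finite d' m' -> simple_config m' -> m' x' = 0%N ->
  (forall l : nat -> R, l @ \oo --> L ->
     local_cvg_seq (fun n => Gamma_geom d' x' m' (l n)) (Gamma_geom d' x' m' L)) ->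
  Q (rball (Gamma_geom d' x' m' L) k) ->
  exists c p q, [/\ good_pattern c p q,
    forall i, i \in c -> exists a,
      [/\ cball d' x' r a, (0 < m' a)%N & d' (D i) a < q.+1%:R^-1] &
    atom_sum m' (cball d' x' r)
      (tent d' x' (rho + p.+1%:R^-1) (rho + p.+1%:R^-1 + p.+1%:R^-1)) <= (size c)%:R].
Proof.
move=> m'f m's m'x reg Qm'.
have [del [del0 delL st1 st2]] := regular_stable k dm' m'f L0 reg.
pose S := cball d' x' rho `&` [set a | (0 < m' a)%N].
have Sf : finite_set S := m'f x' rho.
have small (e : R) : 0 < e -> exists p : nat, p.+1%:R^-1 < e.
  move=> e0; have /cvgr_lt/(_ e e0) := @cvg_harmonic R.
  by move=> /filter_ex [p]; exists p.
(* By local finiteness a shell just beyond [rho] is free of atoms; the cutoff is made to decay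
   inside it. *)
have [e1 e10 e1P] : exists2 e : R, 0 < e &
    forall a, d' x' a <= r -> (0 < m' a)%N -> rho < d' x' a -> rho + e <= d' x' a.
  have [a _|e e0 eP] := finite_pos_lower_bound
      (g := fun a => if rho < d' x' a then d' x' a - rho else 1) (m'f x' r).
    by case: ifP => //; rewrite subr_gt0.
  exists e => // a ar ma ra; have := eP a (conj ar ma); rewrite ra; lra.
have [p pP] : exists p : nat, p.+1%:R^-1 < Num.min e1 1 / 2.
  by apply: small; rewrite divr_gt0// lt_min e10 ltr01.
set th : R := p.+1%:R^-1 in pP *.
have th0 : 0 < th by rewrite invr_gt0.
have [the1 th1] : 2 * th < e1 /\ 2 * th < 1.
  have : 2 * th < Num.min e1 1 by lra.
  by rewrite lt_min => /andP[].
pose V := [set x'] `|` S.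
have Vf : finite_set V by rewrite finite_setU; split; [exact: finite_set1|].
have [e2 e20 e2P] : exists2 e : R, 0 < e &
    forall u v, V u -> V v -> u <> v -> e <= d' u v.
  have [u _|e e0 eP] := finite_pos_lower_bound
      (g := fun u => if u.1 == u.2 then 1 else d' u.1 u.2) (finite_setX Vf Vf).
    case: eqP => // n12; rewrite lt0r (dist_ge0 dm') andbT.
    by apply/eqP => /(dist_eq0 dm').
  exists e => // u v Vu Vv nuv; have := eP (u, v) (conj Vu Vv) => /=.
  by case: eqP.
(* The factor 8 leaves room for the largest accumulated error below, [5 * eps] in [sgd]: [2 * eps]
   at each endpoint and [eps] from [f N]. *)
have [q qP] : exists q : nat, q.+1%:R^-1 < Num.min e2 (Num.min del th) / 8.
  by apply: small; rewrite divr_gt0// !lt_min e20 del0 th0.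
set eps : R := q.+1%:R^-1 in qP *.
have eps0 : 0 < eps by rewrite invr_gt0.
have [ee2 edel eth] : [/\ 8 * eps < e2, 8 * eps < del & 8 * eps < th].
  have : 8 * eps < Num.min e2 (Num.min del th) by lra.
  by rewrite !lt_min => /and3P[].
have hex a : exists i, d' (D i) a < eps by apply: Dd.
have [i iP] := choice hex.
pose s : seq X' := fset_set S.
have sS a : a \in s <-> S a by rewrite in_fset_set// inE.
have SV a : S a -> V a by right.
have close u v : V u -> V v -> d' u v < 8 * eps -> u = v.
  by move=> Vu Vv uv; apply: contrapT => /(e2P _ _ Vu Vv); lra.
have iI a b : S a -> S b -> i a = i b -> a = b.
  move=> Sa Sb iab; apply: close; [exact: SV|exact: SV|].
  have := iP a; have := iP b; have := dist_tri dm' a (D (i a)) b.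
  by rewrite (dist_sym dm' a (D (i a))) iab; lra.
have rho_r : forall a, S a -> cball d' x' r a.
  by move=> a [h _]; rewrite /cball /= in h *; rewrite rE; lra.
exists [seq i a | a <- s], p, q; split; last 2 first.
- move=> _ /mapP[a /sS Sa ->]; exists a; split=> //; first exact: rho_r.
  by case: Sa.
- rewrite size_map; apply: atom_sum_le_size; first exact: (m'f x' r).
  move=> a ar ma; have [ra|ra] := leP (d' x' a) rho.
    left; split; first by apply/sS.
    have -> : m' a = 1%N by apply/eqP; rewrite eqn_leq m's ma.
    by rewrite mul1r tent_le1.
  right; apply: tent_eq0; first by rewrite ltrDl.
  by have := e1P a ar ma ra; rewrite -/th; lra.
split.
- split=> //.
  + rewrite map_inj_in_uniq ?fset_uniq// => a b /sS Sa /sS Sb; exact: iI.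
  + move=> _ /mapP[a /sS [xa _] ->]; rewrite /cball /= in xa.
    have := dist_tri dm' x' a (D (i a)); rewrite (dist_sym dm' a (D (i a))).
    by have := iP a; rewrite -/th -/eps; lra.
  + move=> _ _ /mapP[a /sS Sa ->] /mapP[b /sS Sb ->] nab.
    have := e2P a b (SV _ Sa) (SV _ Sb) ltac:(by move=> ab; apply: nab; rewrite ab).
    have := iP a; have := iP b; have := dist_tri dm' a (D (i a)) b.
    have := dist_tri dm' (D (i a)) (D (i b)) b.
    by rewrite (dist_sym dm' a (D (i a))) -/eps; lra.
- by rewrite rE -/th; lra.
apply: filterS (lipschitz_distortion eps0) => N [fx fd] w a [aP aall].
have x'x : d' x' x' = 0 by apply/(dist_eq0 dm').
have xx : d (x N) (x N) = 0 by apply/(dist_eq0 (@dm N)).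
(* The root goes to the root, and any other vertex to the atom found in the ball of its own
   centre. *)
pose sg u := if u == x' then x N else a (i u).
have kL0 : 0 <= k%:R * L by rewrite mulr_ge0// ltW.
have xr : cball (@d N) (x N) r (x N) by rewrite /cball /= xx ltW.
have sgP u : V u -> cball (@d N) (x N) r (sg u) /\ d' (f (sg u)) u < 2 * eps.
  rewrite /sg; case: eqP => [-> _|nux [//|Su]].
    by split=> //; rewrite -/eps in fx; lra.
  have [h1 h2 h3] := aP (i u) (map_f i ((sS u).2 Su)); split=> //.
  have := iP u; have := dist_tri dm' (f (a (i u))) (D (i u)) u.
  by rewrite (dist_sym dm' _ (D (i u))) -/eps in h3 *; lra.
have sgd u v : V u -> V v ->
    d (sg u) (sg v) <= d' u v + 5 * eps /\ d' u v <= d (sg u) (sg v) + 5 * eps.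
  move=> Vu Vv; have [Au fu] := sgP u Vu; have [Av fv] := sgP v Vv.
  have [h1 h2] := fd _ _ Au Av.
  have := dist_tri dm' (f (sg u)) u (f (sg v)).
  have := dist_tri dm' u v (f (sg v)); rewrite (dist_sym dm' v (f (sg v))).
  have := dist_tri dm' u (f (sg u)) v; rewrite (dist_sym dm' u (f (sg u))).
  have := dist_tri dm' (f (sg u)) (f (sg v)) v.
  by lra.
apply: Qiso Qm'; first by rewrite /= reach_Gamma; exact: reach_root.
apply: (@geom_ball_riso R (X N) X' (@d N) (x N) (M w) d' x' m' L (L - del) (L + del) L
  k V sg) => //.
- exact: ltW.
- by rewrite gerBl ltW.
- by rewrite lerDl ltW.
- by move=> u [->|[_ mu]]; [left|right].
- move=> u uk; have [->|mu] := reach_vertex uk; first by left.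
  right; split=> //; have := reach_dist dm' _ uk; rewrite subr_ge0 => /(_ delL).
  rewrite /cball /rho /= => /le_trans; apply.
  by rewrite mulrBr; have : 0 <= k%:R * del by [rewrite mulr_ge0// ltW]; lra.
- move=> u v Vu Vv suv; apply: close => //; have [_] := sgd u v Vu Vv.
  by rewrite suv (dist_eq0 (@dm N) _ _).2//; lra.
- by rewrite /sg eqxx.
- move=> u Vu; rewrite /sg; case: eqP => [_|nux]; first by left.
  right; case: Vu => [//|Su].
  by have [] := aP (i u) (map_f i ((sS u).2 Su)).
- move=> v [->|mv] xv; first by exists x'; [left|rewrite /sg eqxx].
  have Av : cball (@d N) (x N) r v.
    by rewrite /cball /= rE /rho; lra.
  have [|_ /mapP[b /sS Sb ->] vE] := aall v Av mv.
    have [h1 _] := fd _ _ xr Av; have := dist_tri dm' x' (f (x N)) (f v).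
    by rewrite (dist_sym dm' x' (f (x N))) /rho; rewrite -/th -/eps in fx h1 *; lra.
  exists b; first exact: SV.
  (* Since [x'] carries no atom, [b] differs from the root and [sg b] is the intended atom. *)
  rewrite /sg; case: eqP => [bx|//]; exfalso.
  by case: Sb => _; rewrite bx /= m'x.
- by move=> u v Vu Vv uv; have [] := sgd u v Vu Vv; lra.
- by move=> u v Vu Vv uv; have [] := sgd u v Vu Vv; lra.
Qed.

End LipschitzLimit.

(** * Convergence of the laws of balls *)

Theorem theorem4p11 (R : realType)
  (* the sequence (X_N, x_N, d_N, M_N), M_N defined on (Om N, P N) *)
  (X : nat -> choiceType) (x : forall N, X N) (d : forall N, X N -> X N -> R)
  (dO : nat -> measure_display) (Om : forall N, measurableType (dO N))
  (P : forall N, probability (Om N) R) (M : forall N, Om N -> X N -> nat)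
  (* the limit (X', x', d', M'), M' defined on (Om', P') *)
  (X' : choiceType) (x' : X') (d' : X' -> X' -> R)
  (dO' : measure_display) (Om' : measurableType dO') (P' : probability Om' R)
  (M' : Om' -> X' -> nat) :
  (forall N, is_metric (d N) /\ proper_metric (d N)) ->
  is_metric d' -> proper_metric d' ->
  (forall N, point_process (d N) (M N)) -> point_process d' M' ->
  (forall N, {ae P N, forall w, simple_config (M N w) /\ M N w (x N) = 0%N}) ->
  {ae P', forall w, simple_config (M' w) /\ M' w x' = 0%N} ->
  lip_cvg x d P M x' d' P' M' ->
  regular x' d' P' M' ->
  forall L : R, 0 < L ->
  local_BS_cvg P (fun N w => Gamma_geom (d N) (x N) (M N w) L)
               P' (fun w => Gamma_geom d' x' (M' w) L).
Proof.
move=> dmp dm' dp' Mpp Mpp' _ simp' lip reg L L0 k n E rt.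
have dm N : is_metric (d N) := (dmp N).1.
have dp N : proper_metric (d N) := (dmp N).2.
have mT N := @measurable_ball_event R (X N) (d N) (x N) (dm N) (dp N) _ _ (M N)
  (Mpp N) L k n E rt (ltW L0).
have mT' := @measurable_ball_event R X' d' x' dm' dp' _ _ M' Mpp' L k n E rt (ltW L0).
set T := fun N => [set w | riso (rball (Gamma_geom (d N) (x N) (M N w) L) k)
  (fin_rgraph E rt)] in mT *.
set T' := [set w | _] in mT' *.
pose r : R := k%:R * L + 1 + 1.
have r0 : 0 < r by rewrite /r; have : 0 <= k%:R * L by [rewrite mulr_ge0// ltW]; lra.
have [N0 [f [g [fg fdil flaw]]]] := lip r r0.
have [D Dd] := proper_dense_sequence dm' x' dp'.
have Af N (w : Om N) : finite_set (cball (d N) (x N) r `&` [set a | (0 < M N w a)%N]).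
  exact: (Mpp N).1.
have Af' w : finite_set (cball d' x' r `&` [set a | (0 < M' w a)%N]).
  exact: Mpp'.1.
pose Lam N (w : Om N) (phi : X' -> R) :=
  atom_sum (M N w) (cball (d N) (x N) r) (fun a => phi (f N a)).
(* The identity is kept explicit so that the lemmas on pullbacks by [f N] also cover the limit. *)
pose Lam' w (phi : X' -> R) := atom_sum (M' w) (cball d' x' r) (fun a => phi (id a)).
have add (Y : choiceType) (m : Y -> nat) (A : set Y) (h : Y -> X') :
    finite_set (A `&` [set a | (0 < m a)%N]) ->
    additive_functional (fun phi : X' -> R => atom_sum m A (fun a => phi (h a))).
  move=> mA; split; last by move=> phi psi; rewrite atom_sumD.
  by rewrite atom_sumE// big1// => a _; rewrite mulr0.
(* Stated for any isomorphism-invariant [Q], because it is needed for an isomorphism type and for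
   its complement. *)
have low (Q : Defs.rgraph -> Prop) :
    (forall G H, rg_set (rg_root G) -> riso G H -> Q G -> Q H) ->
    (forall N, measurable [set w | Q (rball (Gamma_geom (d N) (x N) (M N w) L) k)]) ->
    measurable [set w | Q (rball (Gamma_geom d' x' (M' w) L) k)] ->
    forall e : R, 0 < e -> \forall N \near \oo,
      fine (P' [set w | Q (rball (Gamma_geom d' x' (M' w) L) k)]) - e <=
      fine (P N [set w | Q (rball (Gamma_geom (d N) (x N) (M N w) L) k)]).
  move=> Qiso mQ mQ' e e0.
  pose good := @good_pattern R X x d dO Om M X' x' d' r f L k D Q.
  (* Indices that code no good pattern receive the zero functional, which meets every bound
     trivially. *)
  pose F j l : ((X' -> R) -> R) -> R :=
    if @choice.unpickle (seq nat * nat * nat)%type j is Some (c, p, q) then if `[< good c p q >] then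
      count_functional d' x' D c q.+1%:R^-1 (k%:R * L + 1) p.+1%:R^-1 l
    else fun=> 0 else fun=> 0.
  have t0 := @test_function0 R X' d' x' r.
  have tD := @test_functionD R X' d' x' r.
  have FP (Pr : (((X' -> R) -> R) -> R) -> Prop) j l : Pr (fun=> 0) ->
      (forall c p q, good c p q -> Pr (count_functional d' x' D c q.+1%:R^-1
         (k%:R * L + 1) p.+1%:R^-1 l)) -> Pr (F j l).
    move=> Pr0 Prg; rewrite /F; case: (choice.unpickle j) => [[[c p] q]|//].
    by case: asboolP => // /Prg.
  apply: (@liminf_probability R X' (test_function d' x' r) t0 tD dO Om P Lam
    dO' Om' P' Lam' N0 _ _ _ _ _ _ _ (fun N => [set w | Q _]) _ mQ mQ' F) => //.
  - by move=> N w; exact: add.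
  - by move=> w; exact: (add _ _ _ id).
  - move=> N N0N phi tphi; apply: measurable_pullback_atom_sum tphi => //.
    by have [_ _ _ _ []] := fg N N0N.
  - move=> phi tphi; apply: (measurable_pullback_atom_sum (f := id)) tphi => //.
    by move=> y _ e1 e10; exists e1.
  - by move=> N w phi [p0 _ _ _]; apply: atom_sum_ge0 => // a _; exact: p0.
  - by move=> w phi [p0 _ _ _]; apply: atom_sum_ge0 => // a _; exact: p0.
  - move=> phi tphi; apply: flaw; first by case: tphi.
    exact: test_function_compact.
  - move=> j l; apply: FP; first exact: expalg_cst.
    by move=> c p q [sc pr _]; exact: expalg_count_functional.
  - move=> j l N w; apply: (FP (fun G => 0 <= G (Lam N w) <= 1)).
      by rewrite lexx ler01.
    move=> c p q [sc _ _].
    by have [] := count_functional_bounds dm' (x N) (f N) (Af N w) l sc.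
  - move=> j l w; apply: (FP (fun G => 0 <= G (Lam' w) <= 1)).
      by rewrite lexx ler01.
    move=> c p q [sc _ _].
    by have [] := count_functional_bounds dm' x' id (Af' w) l sc.
  - move=> j; rewrite /F; case: (choice.unpickle j) => [[[c p] q]|]; last first.
      by apply: nearW => N l w _; exact: expR_ge0.
    case: asboolP => [[sc _ ev]|_]; last first.
      by apply: nearW => N l w _; exact: expR_ge0.
    apply: filterS ev => N h l w nQ.
    have [_] := count_functional_bounds dm' (x N) (f N) (Af N w) l sc.
    by apply=> a /h.
  - apply: filterS2 simp' (reg L L0) => w [ws wx] wreg Qw.
    have [c [p [q [gd hit Lpsi]]]] := good_pattern_cover M dm dm' r0 fg fdil L0 erefl Dd
      Qiso (Mpp'.1 w) ws wx wreg Qw.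
    exists (choice.pickle (c, p, q)).
    rewrite (_ : (fun l => _) = (fun l => count_functional d' x' D c q.+1%:R^-1
      (k%:R * L + 1) p.+1%:R^-1 l (Lam' w))); last first.
      by apply/funext => l; rewrite /F choice.pickleK; case: asboolP.
    have [sc _ _] := gd.
    apply: (count_functional_cvg1 (f := id)) => // l.
    by have [/andP[_]] := count_functional_bounds dm' x' id (Af' w) l sc.
have iso1 : forall G H, rg_set (rg_root G) -> riso G H ->
    riso G (fin_rgraph E rt) -> riso H (fin_rgraph E rt).
  by move=> G H Gr GH; apply: riso_trans; exact: riso_sym.
have iso2 : forall G H, rg_set (rg_root G) -> riso G H ->
    ~ riso G (fin_rgraph E rt) -> ~ riso H (fin_rgraph E rt).
  by move=> G H Gr GH nG HE; apply: nG; exact: riso_trans HE.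
have l1 : forall e : R, 0 < e -> \forall N \near \oo,
    fine (P' T') - e <= fine (P N (T N)) := low _ iso1 mT mT'.
(* The lower bound for the complement is the upper bound for [T N]. *)
have l2 : forall e : R, 0 < e -> \forall N \near \oo,
    fine (P' (~` T')) - e <= fine (P N (~` T N)) :=
  low _ iso2 (fun N => measurableC (mT N)) (measurableC mT').
have PC (d1 : measure_display) (O1 : measurableType d1) (P1 : probability O1 R)
    (A : set O1) : measurable A -> fine (P1 (~` A)) = 1 - fine (P1 A).
  move=> mA; rewrite probability_setC// fineB//; exact: fin_num_measure.
rewrite -/T' -(fineK (fin_num_measure P' T' mT')).
apply: cvg_EFin; first by apply: nearW => N; exact: fin_num_measure.
apply/cvgrPdist_le => e e0; apply: filterS2 (l1 e e0) (l2 e e0) => N.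
rewrite !PC// => h1 h2; rewrite /= ler_norml; lra.
Qed.
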